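(* Let $S\subset\mathbb{R}$ be a measurable set and suppose that $|S_a|<a$ for some $a>0$, where $S_a:=(S+a\mathbb{Z})\cap[0,a]$ and $|\cdot|$ denotes Lebesgue measure. Then there is a uniformly discrete set $\Lambda\subset\mathbb{R}$ with uniform density $D(\Lambda)=a$ which is a uniqueness set for $Y_S$.
   Context: Fourier transform: $\hat f(t)=\int_{\mathbb{R}} e^{-2\pi i t x}f(x)\,dx$. $Y$ is the space of continuous functions $f$ on $\mathbb{R}$ with $\sup_{x\in\mathbb{R}}(1+x^2)|f(x)|<\infty$; $Y_S$ is the subspace of those $f\in Y$ with $\hat f=0$ outside $S$. A set $\Lambda\subset\mathbb{R}$ is uniformly discrete if $\inf\{|\lambda-\lambda'|:\lambda,\lambda'\in\Lambda,\lambda\neq\lambda'\}>0$. It has uniform density $D(\Lambda)$ if $\mathrm{Card}(\Lambda\cap(x,x+r))=rD(\Lambda)+o(r)$ uniformly in $x$ as $r\to\infty$. A set $\Lambda$ is a uniqueness set for a space of continuous functions if the only function in the space vanishing on $\Lambda$ is the zero function. *)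

(* Defs.v *)
From mathcomp Require Import all_boot all_order all_algebra.
From mathcomp Require Import all_classical all_reals all_analysis.
Import Order.TTheory GRing.Theory Num.Theory.
Import numFieldNormedType.Exports.
Set Implicit Arguments. Unset Strict Implicit. Unset Printing Implicit Defensive.
Local Open Scope classical_set_scope. Local Open Scope ring_scope.

(* The carrier type of the (completed) Lebesgue measure on R, whose
   measurable sets are exactly the Lebesgue measurable sets. *)
Definition lebesgueType (R : realType) :=
  caratheodory_type (R:=R) (wlength (R:=R) idfun)^*%mu.

Definition lebesgue_measurable (R : realType) (S : set R) : Prop :=
  @measurable _ (lebesgueType R) S.

Definition leb (R : realType) (A : set R) : \bar R :=
  @completed_lebesgue_measure R A.

Definition Sa (R : realType) (S : set R) (a : R) : set R :=
  [set x | (exists k : int, S (x - k%:~R * a)) /\ 0 <= x <= a].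

(* A complex-valued function on R is represented by its real part u and
   imaginary part v : f = u + i v. *)

Definition inY (R : realType) (u v : R -> R) : Prop :=
  continuous u /\ continuous v /\
  exists C : R, forall x : R, (1 + x ^+ 2) * Num.sqrt (u x ^+ 2 + v x ^+ 2) <= C.

(* Real and imaginary parts of the Fourier transform
   \hat f(t) = \int e^{-2 pi i t x} f(x) dx, with f = u + i v:
   e^{-i th}(u + i v) = (u cos th + v sin th) + i (v cos th - u sin th). *)
Definition fourier_re (R : realType) (u v : R -> R) (t : R) : R :=
  Rintegral (@lebesgue_measure R) setT
    (fun x => u x * cos (2 * pi * t * x) + v x * sin (2 * pi * t * x)).

Definition fourier_im (R : realType) (u v : R -> R) (t : R) : R :=
  Rintegral (@lebesgue_measure R) setT
    (fun x => v x * cos (2 * pi * t * x) - u x * sin (2 * pi * t * x)).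

Definition inYS (R : realType) (S : set R) (u v : R -> R) : Prop :=
  inY u v /\ forall t, ~ S t -> fourier_re u v t = 0 /\ fourier_im u v t = 0.

Definition uniformly_discrete (R : realType) (L : set R) : Prop :=
  exists delta : R, 0 < delta /\
    forall l l', L l -> L l' -> l != l' -> delta <= `|l - l'|.

Definition has_uniform_density (R : realType) (L : set R) (D : R) : Prop :=
  forall eps : R, 0 < eps -> exists r0 : R, 0 < r0 /\
    forall r x : R, r0 <= r ->
      exists s : seq R, uniq s /\ [set` s] = L `&` [set y | x < y < x + r] /\
        `|(size s)%:R - r * D| <= eps * r.

Definition uniqueness_set_YS (R : realType) (S : set R) (L : set R) : Prop :=
  forall u v : R -> R, inYS S u v -> (forall l, L l -> u l = 0 /\ v l = 0) ->
    forall x, u x = 0 /\ v x = 0.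

(* Main.v *)
Require Import Defs.
From HB Require Import structures.
From mathcomp Require Import all_boot all_order all_algebra.
From mathcomp Require Import all_classical all_reals all_analysis measurable_realfun.
From mathcomp Require Import ring lra zify.
Import Order.TTheory GRing.Theory Num.Theory.
Import numFieldNormedType.Exports.
From mathcomp Require Import complex.
Import ComplexField.Normc.
Set Implicit Arguments. Unset Strict Implicit. Unset Printing Implicit Defensive.
Local Open Scope classical_set_scope. Local Open Scope ring_scope.

(**
Write [e(x) = exp(2 pi i x)].  Since the outer measure of [S_a] is less than [a], there
is a compact [K] in [[0, a[] of positive measure which misses [S + aZ].  If [f] is in
[Y_S] and [t] is in [K], then the [1/a]-periodization of [f(x) e(-tx)] has the Fourier
coefficients [fhat(t + ka)], which vanish; so it vanishes, and its partial sum over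
[-q <= n < q] is [O(1/q)], because [f(y) = O(1/y^2)].

Suppose that [f(x + n/a) = 0] for [p <= n < q].  Then this partial sum only involves
[n < p] and is, up to a unimodular factor, the value at [e(t/a)] of a polynomial with
coefficients [f(x + n/a)].  A bounded polynomial that is very small on a set of positive
measure has small coefficients: pair it with [exp (l (A - A(0)))], where [Re A]
approximates the indicator function of [K] and [l] is large; this function takes the value
[1] at the origin and is small outside [K].  So if [q] is large enough compared with [p],
all the values [f(x - k/a)] with [0 <= k <= 2p], say, are small.

The set is [{(n + s_n)/a}], where [s_n] is constant, equal to [1 + 1/2 + ... + 1/m], for
[p_m <= n < p_(m+1)], with [(p_m)] growing fast.  The steps of the harmonic numbers tend
to [0], so the density is [a], and their values accumulate modulo [1] at every point;
hence [f] is zero by continuity.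
*)

(** * Complex numbers of modulus one *)

Section ComplexNorm.
Context {R : rcfType}.
Implicit Types (z w : R[i]).

Lemma normc_ge0 z : 0 <= normc z.
Proof. exact: (@normr_ge0 R (Rcomplex R)). Qed.

Lemma sqr_normcE z : normc z ^+ 2 = Re z ^+ 2 + Im z ^+ 2.
Proof. by case: z => a b /=; rewrite sqr_sqrtr// addr_ge0 ?sqr_ge0. Qed.

Lemma ReM z w : Re (z * w) = Re z * Re w - Im z * Im w.
Proof. by case: z w => ? ? []. Qed.

Lemma ImM z w : Im (z * w) = Re z * Im w + Im z * Re w.
Proof. by case: z w => ? ? []. Qed.

Lemma ReMr (x : R) w : Re ((x%:C)%C * w) = x * Re w.
Proof. by rewrite ReM mul0r subr0. Qed.

Lemma Re_sum I (r : seq I) (P : pred I) (F : I -> R[i]) :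
  Re (\sum_(i <- r | P i) F i) = \sum_(i <- r | P i) Re (F i).
Proof. exact: (raddf_sum (@Re R : Rcomplex R -> R)). Qed.

Lemma Im_sum I (r : seq I) (P : pred I) (F : I -> R[i]) :
  Im (\sum_(i <- r | P i) F i) = \sum_(i <- r | P i) Im (F i).
Proof. exact: (raddf_sum (@Im R : Rcomplex R -> R)). Qed.

Lemma normc_sum I (r : seq I) (P : pred I) (F : I -> R[i]) :
  normc (\sum_(i <- r | P i) F i) <= \sum_(i <- r | P i) normc (F i).
Proof. exact: (@ler_norm_sum R (Rcomplex R)). Qed.

Lemma normc_ge_Re z : `|Re z| <= normc z.
Proof. by have := normc_ge_Re z; rewrite lecR. Qed.

Lemma normc_ge_Im z : `|Im z| <= normc z.
Proof. by rewrite -sqrtr_sqr; case: z => a b /=; rewrite ler_wsqrtr// lerDr sqr_ge0. Qed.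

Lemma normcX z n : normc (z ^+ n) = normc z ^+ n.
Proof. by elim: n => [|n IH]; rewrite ?normc1// !exprS normcM IH. Qed.

Lemma normc_phase z : exists2 c : R[i], normc c = 1 & Re (c * z) = normc z.
Proof.
have [->|z0] := eqVneq z 0.
  by exists 1; [exact: normc1|rewrite mulr0 normc0].
have nz : normc z != 0 by apply: contra z0 => /eqP/eq0_normc ->.
exists ((Re z / normc z) +i* (- (Im z / normc z)))%C => /=.
  rewrite sqrrN !expr_div_n -mulrDl -sqr_normcE divff ?sqrtr1//.
  by rewrite expf_neq0.
rewrite ReM /= mulNr opprK !(mulrAC _ _^-1) -mulrDl -!expr2 -sqr_normcE.
by rewrite expr2 mulfK.
Qed.

End ComplexNorm.

(* Locked, since otherwise simplification exposes [cos] and [sin]. *)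
HB.lock Definition cis (R : realType) (x : R) : R[i] :=
  (cos (2 * pi * x) +i* sin (2 * pi * x))%C.
Arguments cis {R} x.

Section Cis.
Context {R : realType}.
Implicit Types x y : R.

Lemma cisE x : cis x = (cos (2 * pi * x) +i* sin (2 * pi * x))%C.
Proof. by rewrite unlock. Qed.

Lemma Re_cis x : Re (cis x) = cos (2 * pi * x). Proof. by rewrite cisE. Qed.

Lemma Im_cis x : Im (cis x) = sin (2 * pi * x). Proof. by rewrite cisE. Qed.

Lemma cis0 : cis (0 : R) = 1.
Proof. by rewrite cisE mulr0 cos0 sin0. Qed.

Lemma cisD x y : cis (x + y) = cis x * cis y.
Proof.
rewrite !cisE mulrDr cosD sinD.
by rewrite -[RHS]/((_ - _) +i* (_ + _))%C; congr (_ +i* _)%C; ring.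
Qed.

Lemma cisN x : cis (- x) = (cis x)^*%C.
Proof. by rewrite !cisE mulrN cosN sinN. Qed.

Lemma cisMn x n : cis (n%:R * x) = cis x ^+ n.
Proof.
elim: n => [|n IH]; first by rewrite mul0r cis0.
by rewrite exprS -IH -cisD; congr cis; rewrite -natr1; ring.
Qed.

Lemma cis_nat n : cis (n%:R : R) = 1.
Proof.
rewrite -[n%:R]mulr1 cisMn cisE mulr1.
by rewrite mulrC mulr_natr cos2pi sin2pi expr1n.
Qed.

Lemma normc_cis x : normc (cis x) = 1.
Proof. by rewrite cisE /= cos2Dsin2 sqrtr1. Qed.

Lemma Re_cis_norm x : Re (cis `|x|) = Re (cis x).
Proof.
by rewrite !Re_cis -[RHS]cos_norm [in RHS]normrM ger0_norm// mulr_ge0// pi_ge0.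
Qed.

Lemma cis_neq1 x : 0 < `|x| < 1 -> cis x != 1.
Proof.
move=> /andP[x0 x1]; apply/eqP => /(congr1 (@Re R)).
rewrite -Re_cis_norm Re_cis -mulrA mulr_natl cos_mulr2n /= => cos1.
have /eqP : sin (pi * `|x|) ^+ 2 = 0 by rewrite sin2cos2; lra.
rewrite expf_eq0 gt_eqF// sin_gt0_pi// mulr_gt0 ?pi_gt0//=.
by rewrite gtr_pMr ?pi_gt0.
Qed.

Definition chord x y : R := normc (cis x - cis y).

Lemma chord_ge0 x y : 0 <= chord x y. Proof. exact: normc_ge0. Qed.

Lemma chordxx x : chord x x = 0. Proof. by rewrite /chord subrr normc0. Qed.

Lemma chordC x y : chord x y = chord y x.
Proof. exact: (@distrC R (Rcomplex R)). Qed.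

Lemma chord_triangle x y z : chord x z <= chord x y + chord y z.
Proof. exact: (@ler_distD R (Rcomplex R)). Qed.

Lemma chord_sub x y : chord x y = normc (1 - cis (x - y)).
Proof.
rewrite chordC /chord; have -> : cis y - cis x = cis y * (1 - cis (x - y)).
  by rewrite mulrBr mulr1 -cisD subrKC.
by rewrite normcM normc_cis mul1r.
Qed.

Lemma chord_gt0 x y : 0 < `|x - y| < 1 -> 0 < chord x y.
Proof.
move=> /cis_neq1 xy1; rewrite lt_def chord_ge0 andbT chord_sub.
by apply: contra xy1 => /eqP/eq0_normc/subr0_eq <-.
Qed.

End Cis.

Section ContinuousComplex.
Context {R : realType} {T : topologicalType}.
Implicit Types f g : T -> R[i].

Definition continuousC f : Prop :=
  continuous (fun x => Re (f x)) /\ continuous (fun x => Im (f x)).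

Lemma continuous_bigsum I (r : seq I) (F : I -> T -> R) :
  (forall i, continuous (F i)) -> continuous (fun x => \sum_(i <- r) F i x).
Proof. by move=> cF; apply: continuous_big => //; exact: add_continuous. Qed.

Lemma continuousC_cst (z : R[i]) : continuousC (fun=> z).
Proof. by split=> x; exact: cvg_cst. Qed.

Lemma continuousC_mul f g :
  continuousC f -> continuousC g -> continuousC (fun x => f x * g x).
Proof.
move=> [fr fi] [gr gi]; split=> x.
- by under eq_fun do rewrite ReM; apply: cvgB; apply: cvgM; move: x.
- by under eq_fun do rewrite ImM; apply: cvgD; apply: cvgM; move: x.
Qed.

Lemma continuousC_sum I (r : seq I) (F : I -> T -> R[i]) :
  (forall i, continuousC (F i)) -> continuousC (fun x => \sum_(i <- r) F i x).
Proof.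
move=> cF; split=> x.
- under eq_fun do rewrite Re_sum.
  by move: x; apply: continuous_bigsum => i; case: (cF i).
- under eq_fun do rewrite Im_sum.
  by move: x; apply: continuous_bigsum => i; case: (cF i).
Qed.

Lemma continuousC_exp f n : continuousC f -> continuousC (fun x => f x ^+ n).
Proof.
move=> cf; elim: n => [|n IH]; first exact: continuousC_cst.
by under eq_fun do rewrite exprS; exact: continuousC_mul.
Qed.

Lemma continuousC_horner (p : {poly R[i]}) f :
  continuousC f -> continuousC (fun x => p.[f x]).
Proof.
move=> cf; under eq_fun do rewrite horner_coef.
apply: continuousC_sum => i; apply: continuousC_mul; first exact: continuousC_cst.
exact: continuousC_exp.
Qed.

Lemma continuousC_cis (g : T -> R) : continuous g -> continuousC (fun x => cis (g x)).
Proof.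
move=> cg; have cpg : continuous (fun x => 2 * pi * g x).
  by move=> x; apply: cvgM; [exact: cvg_cst|exact: cg].
split=> x.
- under eq_fun do rewrite Re_cis.
  by apply: continuous_comp; [exact: cpg|exact: continuous_cos].
- under eq_fun do rewrite Im_cis.
  by apply: continuous_comp; [exact: cpg|exact: continuous_sin].
Qed.

Lemma continuous_normc f : continuousC f -> continuous (fun x => normc (f x)).
Proof.
move=> [fr fi] x.
have E y : normc (f y) = Num.sqrt (Re (f y) ^+ 2 + Im (f y) ^+ 2) by case: (f y).
under eq_fun do rewrite E.
apply: continuous_comp; last exact: sqrt_continuous.
by apply: cvgD; apply: cvgM; move: x.
Qed.

End ContinuousComplex.

Section ContinuousTrigonometric.
Context {R : realType}.
Implicit Types (p : {poly R[i]}) (w x : R).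

Lemma continuousC_cis_mull w : continuousC (fun x : R => cis (w * x)).
Proof. exact/continuousC_cis/mulrl_continuous. Qed.

Lemma continuous_Re_horner p w : continuous (fun x => Re p.[cis (w * x)]).
Proof. by have [] := continuousC_horner p (continuousC_cis_mull w). Qed.

Lemma continuous_normc_horner p w : continuous (fun x => normc p.[cis (w * x)]).
Proof. exact/continuous_normc/continuousC_horner/continuousC_cis_mull. Qed.

Lemma continuous_chord x : continuous (chord x).
Proof.
have E y : chord x y = normc ((cis x)%:P - 'X).[cis y] by rewrite !hornerE.
rewrite (funext E); apply/continuous_normc/continuousC_horner/continuousC_cis => y.
exact: cvg_id.
Qed.

End ContinuousTrigonometric.

(** * Trigonometric approximation *)

Section Fejer.
Context {R : realType}.
Implicit Types (x y eta : R) (n : nat).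

Definition fejer n x : R := normc (\sum_(k < n) cis (k%:R * x)) ^+ 2 / n%:R.

Lemma fejer_ge0 n x : 0 <= fejer n x.
Proof. by rewrite divr_ge0// exprn_ge0// normc_ge0. Qed.

Lemma fejerE n x : fejer n x =
  n%:R^-1 * \sum_(k < n) \sum_(l < n) Re (cis ((k%:R - l%:R) * x)).
Proof.
rewrite /fejer mulrC; congr (_ * _).
set z := (X in normc X).
have -> : normc z ^+ 2 = Re (z * z^*%C).
  by rewrite sqr_normcE; case: z => a b /=; ring.
have -> : z^*%C = \sum_(l < n) cis (- (l%:R * x)).
  by rewrite rmorph_sum; apply: eq_bigr => l _; rewrite cisN.
rewrite mulr_suml Re_sum; apply: eq_bigr => k _.
rewrite mulr_sumr Re_sum; apply: eq_bigr => l _.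
by rewrite -cisD; congr (Re (cis _)); ring.
Qed.

Lemma fejer_chord n x y : (0 < n)%N -> chord x y ^+ 2 * fejer n (x - y) <= 4 / n%:R.
Proof.
move=> n0; rewrite /fejer mulrA ler_pM2r ?invr_gt0 ?ltr0n//.
rewrite chord_sub -exprMn -normcM.
under eq_bigr do rewrite cisMn.
have -> : (1 - cis (x - y)) * (\sum_(i < n) cis (x - y) ^+ i) =
    1 - cis (n%:R * (x - y)).
  by rewrite cisMn -opprB mulNr -subrX1 opprB.
have -> : 4 = 2 ^+ 2 :> R by ring.
rewrite lerXn2r ?nnegrE ?normc_ge0//.
by rewrite (le_trans (le_normcD _ _))// normcN normc_cis normc1 -natr1.
Qed.

Lemma sum_cis_nodes n (d : int) : (0 < `|d| < n)%N ->
  \sum_(j < n) cis (- d%:~R / n%:R * j%:R : R) = 0.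
Proof.
move=> /andP[d0 dn]; set w : R := - d%:~R / n%:R.
have n0 : (0 : R) < n%:R by rewrite ltr0n (leq_ltn_trans _ dn).
have w1 : cis w - 1 != 0.
  rewrite subr_eq0 cis_neq1// normrM normrN normfV (gtr0_norm n0).
  rewrite ltr_pdivrMr// mul1r divr_gt0//= -intr_norm -natr_absz ?ltr0n//.
  by rewrite ltr_nat.
under eq_bigr do rewrite mulrC cisMn.
apply: (mulfI w1); rewrite mulr0 -subrX1 -cisMn /w mulrC mulfVK ?gt_eqF// cisN.
apply/eqP; rewrite subr_eq0; apply/eqP.
case: d {d0 dn w w1} => k; first by rewrite -pmulrn cis_nat conjc1.
by rewrite NegzE mulrNz cisN conjcK -pmulrn cis_nat.
Qed.

Lemma sum_fejer_nodes n x : (0 < n)%N -> \sum_(j < n) fejer n (x - j%:R / n%:R) = n%:R.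
Proof.
move=> n0; have nn : n%:R != 0 :> R by rewrite pnatr_eq0 -lt0n.
under eq_bigr do rewrite fejerE.
rewrite -mulr_sumr exchange_big /= (eq_bigr (fun=> n%:R)).
  by rewrite sumr_const card_ord -[n%:R *+ n]mulr_natl mulKf.
move=> k _; rewrite exchange_big /= (bigD1 k)//= [X in _ + X]big1 ?addr0.
  under eq_bigr do rewrite subrr mul0r cis0.
  by rewrite sumr_const card_ord.
move=> l lk; rewrite -Re_sum.
have -> : \sum_(j < n) cis ((k%:R - l%:R) * (x - j%:R / n%:R)) =
    cis ((k%:R - l%:R) * x) * \sum_(j < n) cis (- (k%:Z - l%:Z)%:~R / n%:R * j%:R).
  rewrite mulr_sumr; apply: eq_bigr => j _; rewrite -cisD; congr cis.
  by rewrite intrB -!pmulrn; ring.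
rewrite sum_cis_nodes ?mulr0//.
have := ltn_ord k; have := ltn_ord l.
by move: lk; rewrite -val_eqE /= neq_ltn; lia.
Qed.

Lemma sum_fejer_nodes_chord n x eta : (0 < n)%N -> 0 < eta ->
  \sum_(j < n) fejer n (x - j%:R / n%:R) / n%:R * chord x (j%:R / n%:R) <=
    eta / 2 + 2 / (eta * n%:R).
Proof.
move=> n0 eta0; have nR : 0 < n%:R :> R by rewrite ltr0n.
have amgm (c : R) : c <= eta / 2 + c ^+ 2 / (2 * eta).
  rewrite -subr_ge0; have -> : eta / 2 + c ^+ 2 / (2 * eta) - c =
    (eta - c) ^+ 2 / (2 * eta) by field; rewrite gt_eqF.
  by rewrite divr_ge0 ?sqr_ge0// mulr_ge0// ltW.
pose b (j : 'I_n) := eta / 2 * (fejer n (x - j%:R / n%:R) / n%:R) +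
   2 / eta / n%:R ^+ 2.
apply: (@le_trans _ _ (\sum_(j < n) b j)).
  apply: ler_sum => j _; rewrite /b; set y := j%:R / n%:R; set F := fejer n _.
  have F0 : 0 <= F / n%:R by rewrite divr_ge0// fejer_ge0.
  apply: le_trans (ler_wpM2l F0 (amgm _)) _.
  rewrite mulrDr [F / _ * _]mulrC lerD2l.
  have -> : F / n%:R * (chord x y ^+ 2 / (2 * eta)) =
    (chord x y ^+ 2 * F) / (2 * eta * n%:R) by field; rewrite !gt_eqF.
  rewrite ler_pdivrMr ?mulr_gt0//; apply: le_trans (fejer_chord x y n0) _.
  by rewrite le_eqVlt; apply/orP; left; apply/eqP; field; rewrite !gt_eqF.
rewrite big_split/= -mulr_sumr -mulr_suml sum_fejer_nodes// divff ?gt_eqF// mulr1.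
rewrite lerD2l sumr_const card_ord -[_ *+ n]mulr_natr le_eqVlt.
by apply/orP; left; apply/eqP; field; rewrite !gt_eqF.
Qed.

Definition fejer_poly n y : {poly R[i]} := (n%:R^-1 : R)%:C%C *:
  \sum_(kl : 'I_n * 'I_n)
    cis (- (`|kl.1%:Z - kl.2%:Z|%N%:R * y)) *: 'X^(`|kl.1%:Z - kl.2%:Z|%N).

Lemma Re_fejer_poly n x y : Re (fejer_poly n y).[cis x] = fejer n (x - y).
Proof.
rewrite hornerZ ReMr fejerE pair_big /=; congr (_ * _).
rewrite horner_sum Re_sum; apply: eq_bigr => -[k l] _ /=.
rewrite hornerZ hornerXn -cisMn -cisD [- _ + _]addrC -mulrBr.
rewrite natr_absz intr_norm intrB -!pmulrn.
by rewrite -Re_cis_norm normrM normr_id -normrM Re_cis_norm.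
Qed.

End Fejer.

Section CircleLipschitz.
Context {R : realType}.
Implicit Types (phi : R -> R) (A B : set R).

Definition circle_lipschitz phi : Prop :=
  exists2 L : R, 0 <= L & forall x y, `|phi x - phi y| <= L * chord x y.

Lemma circle_lipschitz_nat phi x n : circle_lipschitz phi -> phi (x + n%:R) = phi x.
Proof.
move=> [L L0 phiL]; apply/eqP; rewrite -subr_eq0 -normr_le0.
apply: le_trans (phiL _ _) _.
by rewrite chord_sub [x + _]addrC addrK cis_nat subrr normc0 mulr0.
Qed.

Lemma continuous_circle_lipschitz phi : circle_lipschitz phi -> continuous phi.
Proof.
move=> [L L0 phiL] x; apply/cvgrPdist_le => e e0.
have : L * chord x y @[y --> x] --> L * chord x x.
  by apply: cvgM; [exact: cvg_cst|exact: continuous_chord].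
rewrite chordxx mulr0 => /cvgrPdist_le /(_ e e0); apply: filterS => y.
rewrite sub0r normrN; apply: le_trans; apply: le_trans (phiL _ _) _.
exact: ler_norm.
Qed.

(* The Fejer means of [phi], sampled at the [n] points [j / n]. *)
Lemma trig_approx phi (eps : R) : circle_lipschitz phi -> 0 < eps ->
  exists p : {poly R[i]}, forall x, `|Re p.[cis x] - phi x| <= eps.
Proof.
move=> [L L0 phiL] eps0.
have L1 : 0 < L + 1 by rewrite ltr_wpDl.
pose eta := eps / (L + 1); have eta0 : 0 < eta by exact: divr_gt0.
pose n := (Num.truncn (4 / eta ^+ 2)).+1.
have n0 : 0 < n%:R :> R by rewrite ltr0n.
have chord_small x :
    \sum_(j < n) fejer n (x - j%:R / n%:R) / n%:R * chord x (j%:R / n%:R) <= eta.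
  apply: le_trans (sum_fejer_nodes_chord x _ eta0) _ => //.
  suff : 2 / (eta * n%:R) <= eta / 2 by lra.
  rewrite ler_pdivrMr; last exact: mulr_gt0.
  have : 4 / eta ^+ 2 < n%:R by exact: truncnS_gt.
  rewrite ltr_pdivrMr ?exprn_gt0// => /ltW.
  have -> : eta / 2 * (eta * n%:R) = n%:R * eta ^+ 2 / 2 by ring.
  lra.
exists (\sum_(j < n) (phi (j%:R / n%:R) / n%:R)%:C%C *: fejer_poly n (j%:R / n%:R)) => x.
have phi_mean : phi x = \sum_(j < n) fejer n (x - j%:R / n%:R) / n%:R * phi x.
  by rewrite -2!mulr_suml sum_fejer_nodes// divff ?mul1r// gt_eqF.
rewrite horner_sum Re_sum [in X in _ - X]phi_mean -sumrB.
apply: le_trans (ler_norm_sum _ _ _) _.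
apply: (@le_trans _ _ (L * eta)); last first.
  by rewrite /eta mulrCA ler_piMr ?(ltW eps0)// ler_pdivrMr// mul1r lerDl.
apply: le_trans (ler_wpM2l L0 (chord_small x)); rewrite mulr_sumr; apply: ler_sum => j _.
set y := j%:R / n%:R; rewrite hornerZ ReMr Re_fejer_poly.
have -> : phi y / n%:R * fejer n (x - y) - fejer n (x - y) / n%:R * phi x =
  fejer n (x - y) / n%:R * (phi y - phi x) by ring.
have F0 : 0 <= fejer n (x - y) / n%:R by rewrite divr_ge0// fejer_ge0.
by rewrite normrM (ger0_norm F0) mulrCA ler_wpM2l// chordC phiL.
Qed.

Lemma chord_bounded_below A B : compact A -> compact B ->
  (forall x y, A x -> B y -> 0 < chord x y) ->
  exists2 w : R, 0 < w & forall x y, A x -> B y -> w <= chord x y.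
Proof.
move=> cA cB ABgt0.
have [AB0|/set0P AB0] := eqVneq (A `*` B) set0.
  by exists 1 => // x y Ax By; exfalso; rewrite -[False]/(set0 (x, y)) -AB0.
have cchord : continuous (fun z : R * R => chord z.1 z.2).
  move=> z; have E (u : R * R) : chord u.1 u.2 = normc (1 - 'X).[cis (u.1 - u.2)].
    by rewrite chord_sub !hornerE.
  rewrite (funext E); move: z.
  apply/continuous_normc/continuousC_horner/continuousC_cis => z.
  by apply: cvgB; [exact: cvg_fst|exact: cvg_snd].
have [[x y] /[!inE]-[/= Ax By] xy_min] := compact_EVT_min AB0 (compact_setX cA cB)
  (continuous_subspaceT cchord).
exists (chord x y); first exact: ABgt0.
by move=> x' y' Ax' By'; apply: (xy_min (x', y')); rewrite inE.
Qed.

Lemma circle_urysohn A B : compact A -> compact B ->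
  (forall x y, A x -> B y -> 0 < chord x y) ->
  exists2 phi, circle_lipschitz phi & [/\ forall x, 0 <= phi x <= 1,
    forall x, A x -> phi x = 1 & forall x, B x -> phi x = 0].
Proof.
move=> cA cB /(chord_bounded_below cA cB)[w w0 ABw].
have [->|/set0P[b Bb]] := eqVneq B set0.
  exists (fun=> 1); last by split=> // x; rewrite ler01 lexx.
  by exists 0 => // x y; rewrite subrr normr0 mul0r.
pose d x := inf [set chord x y | y in B].
have hlb x : has_lbound [set chord x y | y in B].
  by exists 0 => _ [y _ <-]; exact: chord_ge0.
have d_le x y : B y -> d x <= chord x y by move=> By; apply: ge_inf => //; exists y.
have d_ge x r : (forall y, B y -> r <= chord x y) -> r <= d x.
  by move=> h; apply: lb_le_inf => [|_ [y By <-]]; [exists (chord x b), b|exact: h].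
have d_lip x y : d x <= chord x y + d y.
  rewrite -lerBlDl; apply: d_ge => z Bz; rewrite lerBlDl.
  exact: le_trans (d_le _ _ Bz) (chord_triangle _ _ _).
exists (fun x => Num.min 1 (d x / w)).
  exists w^-1 => [|x y]; first by rewrite invr_ge0 ltW.
  have half x' y' : Num.min 1 (d x' / w) <= Num.min 1 (d y' / w) + w^-1 * chord x' y'.
    have c0 : 0 <= w^-1 * chord x' y' by rewrite mulr_ge0 ?chord_ge0// invr_ge0 ltW.
    rewrite addr_minl le_min !ge_min lerDl c0/=; apply/orP; right.
    by rewrite [w^-1 * _]mulrC -mulrDl addrC ler_pM2r ?invr_gt0.
  rewrite ler_norml; have := half y x; rewrite chordC; have := half x y.
  lra.
split=> [x|x Ax|x Bx].
- rewrite ge_min lexx le_min ler01 divr_ge0 ?(ltW w0)//.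
  by apply: d_ge => y _; exact: chord_ge0.
- by apply/min_idPl; rewrite ler_pdivlMr// mul1r; apply: d_ge => y; exact: ABw.
- have -> : d x = 0.
    by apply/eqP; rewrite eq_le -{1}(chordxx x) d_le//= d_ge// => y _; exact: chord_ge0.
  by rewrite mul0r; apply/min_idPr.
Qed.

End CircleLipschitz.

(** * Periodization *)

Section RintegralSum.
Context d (T : measurableType d) (R : realType) (mu : {measure set T -> \bar R}).
Implicit Types (A D : set T).

Lemma integrable_sum_EFin D I (r : seq I) (F : I -> T -> R) :
  measurable D -> (forall i, mu.-integrable D (EFin \o F i)) ->
  mu.-integrable D (EFin \o (fun x => \sum_(i <- r) F i x)).
Proof.
move=> mD iF.
have := @integrable_sum _ _ _ mu D mD I r xpredT (fun i => EFin \o F i) (fun i _ => iF i).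
by congr (_.-integrable _ _); apply/funext => x /=; rewrite sumEFin.
Qed.

Lemma Rintegral_sum D I (r : seq I) (F : I -> T -> R) :
  measurable D -> (forall i, mu.-integrable D (EFin \o F i)) ->
  \int[mu]_(x in D) (\sum_(i <- r) F i x) = \sum_(i <- r) \int[mu]_(x in D) F i x.
Proof.
move=> mD iF; elim: r => [|i r IH].
  rewrite big_nil; under eq_Rintegral do rewrite big_nil.
  by rewrite Rintegral_cst// mul0r.
rewrite big_cons -IH; under eq_Rintegral do rewrite big_cons.
by rewrite RintegralD//; exact: integrable_sum_EFin.
Qed.

Lemma Rintegral_setD A D (h : T -> R) : measurable A -> measurable D -> A `<=` D ->
  mu.-integrable D (EFin \o h) ->
  \int[mu]_(x in D) h x = \int[mu]_(x in A) h x + \int[mu]_(x in D `\` A) h x.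
Proof.
move=> mA mD AD ih; rewrite -{1}(setDUK AD) Rintegral_setU ?setDUK//.
- exact: measurableD.
- by apply/disj_setPS => x [? []].
Qed.

Lemma integrable_cst_set A (r : R) : measurable A -> (mu A < +oo)%E ->
  mu.-integrable A (EFin \o cst r).
Proof.
move=> mA Aoo; apply: measurable_bounded_integrable => //.
by exists `|r|; split; [exact: num_real|move=> M rM x _; exact: ltW].
Qed.

Lemma Rintegral_le_cst A (h : T -> R) (r : R) : measurable A -> (mu A < +oo)%E ->
  mu.-integrable A (EFin \o h) -> (forall x, A x -> h x <= r) ->
  \int[mu]_(x in A) h x <= r * fine (mu A).
Proof.
move=> mA Aoo ih h_le; rewrite -Rintegral_cst//; apply: le_Rintegral => //.
exact: integrable_cst_set.
Qed.

Lemma Rintegral_ge_cst A (h : T -> R) (r : R) : measurable A -> (mu A < +oo)%E ->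
  mu.-integrable A (EFin \o h) -> (forall x, A x -> r <= h x) ->
  r * fine (mu A) <= \int[mu]_(x in A) h x.
Proof.
move=> mA Aoo ih h_ge; rewrite -Rintegral_cst//; apply: le_Rintegral => //.
exact: integrable_cst_set.
Qed.

Lemma cvg_Rintegral_exhaust (A : nat -> set T) (h : T -> R) :
  (forall n, measurable (A n)) -> (forall x, \forall n \near \oo, A n x) ->
  mu.-integrable setT (EFin \o h) ->
  \int[mu]_(x in A n) h x @[n --> \oo] --> \int[mu]_x h x.
Proof.
move=> mA Acover ih; have mh := (integrableP _ _ _ ih).1.
have [] := @dominated_convergence _ _ _ mu setT measurableT
  (fun n => EFin \o (h \_ (A n))) (EFin \o h) (fun x => `|(h x)%:E|%E).
- move=> n; apply/measurable_EFinP/(measurable_restrictT h (mA n)).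
  by apply: measurable_funTS; exact/measurable_EFinP.
- exact: mh.
- apply: aeW => x _; apply: cvg_near_cst; apply: filterS (Acover x) => n Anx.
  by rewrite /= patchE mem_set.
- exact: integrable_abse.
- by apply: aeW => x n _ /=; rewrite lee_fin patchE; case: ifP; rewrite ?normr0.
move=> _ _; rewrite -[X in _ --> X]fineK; last exact: integrable_fin_num.
move=> /fine_cvgP[_]; apply: cvg_trans; apply: near_eq_cvg; apply: nearW => n.
by rewrite /= Rintegral_mkcond.
Qed.

End RintegralSum.

Section LebesgueIntegral.
Context {R : realType}.
Notation mu := (@lebesgue_measure R).
Implicit Types (h k : R -> R) (c d P : R).

Lemma integrable_continuous_itv h c d :
  continuous h -> mu.-integrable `[c, d] (EFin \o h).
Proof.
move=> ch; apply: continuous_compact_integrable; first exact: segment_compact.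
exact: continuous_subspaceT.
Qed.

Lemma lebesgue_measure_period P : 0 < P -> mu `[0, P[ = P%:E.
Proof. by move=> P0; rewrite lebesgue_measure_itv/= lte_fin P0 -EFinB subr0. Qed.

Lemma Rintegral_itv_cst (r c d : R) : c <= d -> \int[mu]_(_ in `[c, d]) r = r * (d - c).
Proof.
move=> cd; rewrite Rintegral_cst// [X in fine X]lebesgue_measure_itv/= lte_fin.
by case: ltP => //= dc; rewrite (@le_anti _ _ c d) ?subrr// cd dc.
Qed.

Lemma Rintegral_itv_gt0 k (c d x0 : R) : continuous k -> c < x0 < d -> 0 < k x0 ->
  (forall x, c <= x <= d -> 0 <= k x) -> 0 < \int[mu]_(x in `[c, d]) k x.
Proof.
move=> ck /andP[cx0 x0d] k0 kge0.
have [r r0 k_gt] : exists2 r : R, 0 < r & forall x, `|x0 - x| < r -> k x0 / 2 < k x.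
  have : \forall x \near x0, k x0 / 2 < k x.
    by apply: cvgr_gt (ck x0) _ _; rewrite ltr_pdivrMr// ltr_pMr// ltr1n.
  by move=> /nbhs_ballP[r /= r0 k_gt]; exists r.
pose e := Num.min (r / 2) (Num.min (x0 - c) (d - x0)).
have e0 : 0 < e by rewrite !lt_min divr_gt0// !subr_gt0 cx0.
have [er ec ed] : [/\ e <= r / 2, e <= x0 - c & e <= d - x0].
  by rewrite !ge_min !lexx !orbT.
have sub : `[x0 - e, x0 + e]%classic `<=` `[c, d]%classic.
  by apply: subset_itv; rewrite bnd_simp; lra.
have ik : mu.-integrable `[c, d] (EFin \o k) by exact: integrable_continuous_itv.
apply: (@lt_le_trans _ _ (\int[mu]_(x in `[x0 - e, x0 + e]) (k x0 / 2))).
  rewrite Rintegral_itv_cst; last lra.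
  by rewrite mulr_gt0 ?divr_gt0//; lra.
apply: (@le_trans _ _ (\int[mu]_(x in `[x0 - e, x0 + e]) k x)).
  apply: le_Rintegral => // [||x /=].
  - by apply: integrable_continuous_itv => x; exact: cvg_cst.
  - exact: integrable_continuous_itv.
  - rewrite in_itv/= => xe; apply/ltW/k_gt; rewrite distrC.
    by apply: (@le_lt_trans _ _ e); [rewrite ler_norml; lra|lra].
rewrite [leRHS](@Rintegral_setD _ _ R mu _ _ k _ _ sub)//.
by rewrite lerDl; apply: Rintegral_ge0 => x [/= + _]; rewrite in_itv; exact: kge0.
Qed.

Lemma Rintegral_itv_shift h (c d s : R) : c <= d -> continuous h ->
  \int[mu]_(x in `[c, d]) h (x + s) = \int[mu]_(x in `[c + s, d + s]) h x.
Proof.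
move=> cd ch; pose F (x : R) := x + s.
have dF (x : R) : is_derive x 1 F 1.
  by apply: is_derive_eq; rewrite addr0.
have F'1 : F^`()%classic = fun=> 1 by apply/funext => x; rewrite derive1E derive_val.
have cF : continuous F by move=> x; apply: cvgD; [exact: cvg_id|exact: cvg_cst].
rewrite /Rintegral -/(F c) -/(F d).
rewrite (@integration_by_substitution_increasing _ F) ?F'1//.
- by congr fine; apply: eq_integral => x _ /=; rewrite mulr1.
- by move=> x y _ _; rewrite ltrD2r.
- by move=> x _; exact: cvg_cst.
- by apply/cvg_ex; exists 1; exact: cvg_cst.
- by apply/cvg_ex; exists 1; exact: cvg_cst.
- split=> [x _||]; first exact: ex_derive.
  + exact/cvg_at_right_filter/cF.
  + exact/cvg_at_left_filter/cF.
- exact: continuous_subspaceT.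
Qed.

Lemma Rintegral_cells h c P (m : nat) : 0 < P -> continuous h ->
  \int[mu]_(x in `[c, c + m%:R * P]) h x =
  \sum_(j < m) \int[mu]_(x in `[c + j%:R * P, c + j%:R * P + P]) h x.
Proof.
move=> P0 ch; elim: m => [|m IH].
  by rewrite big_ord0 mul0r addr0 set_itv1 Rintegral_set1.
have mP0 : 0 <= m%:R * P by rewrite mulr_ge0// ltW.
rewrite big_ord_recr/= -IH.
have -> : c + m.+1%:R * P = c + m%:R * P + P by rewrite -natr1; ring.
have := @Rintegral_itvB R h (BLeft c) (BRight (c + m%:R * P + P)) (c + m%:R * P)
  (integrable_continuous_itv _ _ ch).
rewrite !bnd_simp !lerDl mP0 (ltW P0) => /(_ isT isT) splitE.
rewrite -(@Rintegral_itv_obnd_cbnd R (c + m%:R * P)).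
  by rewrite -splitE subrKC.
apply: (@integrableS _ _ _ mu `[c + m%:R * P, c + m%:R * P + P]) => //.
  by apply: subset_itvr; rewrite bnd_simp.
exact: integrable_continuous_itv.
Qed.

Lemma integrable_oneDsqrV : mu.-integrable setT (fun x : R => ((1 + x ^+ 2)^-1)%:E).
Proof.
apply/integrableP; split.
  apply/measurable_EFinP; apply: continuous_measurable_fun.
  exact: continuous_oneDsqrV.
rewrite (@eq_integral _ _ _ mu _ (fun x => ((oneDsqr x)^-1)%:E)); last first.
  by move=> x _ /=; rewrite ger0_norm// invr_ge0 addr_ge0// sqr_ge0.
rewrite ge0_symfun_integralT//.
- have -> : [set x : R | 0 <= x] = `[0, +oo[%classic.
    by apply/seteqP; split => x /=; rewrite in_itv/= andbT.
  by rewrite integral0y_oneDsqr -EFinM ltry.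
- exact: continuous_oneDsqrV.
- by move=> x /=; rewrite /oneDsqr sqrrN.
Qed.

Definition quadratic_decay (C : R) h : Prop := forall x, h x <= C / (1 + x ^+ 2).

Lemma quadratic_decay_cst_ge0 (C : R) h :
  (forall x, 0 <= h x) -> quadratic_decay C h -> 0 <= C.
Proof. by move=> h0 /(_ 0)/(le_trans (h0 _)); rewrite expr0n addr0 divr1. Qed.

Lemma quadratic_decay_le (C r x : R) h : 0 <= C -> quadratic_decay C h ->
  0 < r -> r <= `|x| -> h x <= C / r ^+ 2.
Proof.
move=> C0 hC r0 rx; apply: le_trans (hC x) _.
rewrite ler_wpM2l// lef_pV2 ?posrE ?exprn_gt0 ?ltr_wpDr ?sqr_ge0//.
apply: ler_wpDl => //.
by rewrite -[leRHS]real_normK ?num_real// lerXn2r ?nnegrE ?(ltW r0).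
Qed.

Lemma quadratic_decay_bounded (C x : R) h : 0 <= C -> quadratic_decay C h -> h x <= C.
Proof.
move=> C0 hC; apply: le_trans (hC x) _.
by rewrite ler_pdivrMr ?ltr_wpDr ?sqr_ge0// ler_peMr// lerDl sqr_ge0.
Qed.

Lemma integrable_decay h (C : R) : continuous h ->
  quadratic_decay C (Num.norm \o h) -> mu.-integrable setT (EFin \o h).
Proof.
move=> ch hC; apply: (@le_integrable _ _ _ mu setT measurableT _
  (fun x : R => C%:E * ((1 + x ^+ 2)^-1)%:E)%E) => //.
- by apply/measurable_EFinP; exact: continuous_measurable_fun.
- by move=> x _ /=; rewrite lee_fin (le_trans (hC x))// ler_norm.
- by apply: integrableZl => //; exact: integrable_oneDsqrV.
Qed.

Lemma integrable_decayM h k (C M : R) : continuous h -> continuous k ->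
  quadratic_decay C (Num.norm \o h) -> (forall x, `|k x| <= M) ->
  mu.-integrable setT (EFin \o (fun x => h x * k x)).
Proof.
move=> ch ck hC kM; apply: (@integrable_decay _ (C * M)) => x.
  by apply: cvgM; [exact: ch|exact: ck].
by rewrite /= normrM mulrAC; apply: ler_pM => //; exact: hC.
Qed.

End LebesgueIntegral.

Section Periodization.
Context {R : realType}.
Notation mu := (@lebesgue_measure R).

Definition periodization (V : nmodType) (g : R -> V) (P : R) (n : nat) (x : R) : V :=
  \sum_(i < n + n) g (x + (i%:R - n%:R) * P).

Lemma periodizationS (V : nmodType) (g : R -> V) P n x :
  periodization g P n.+1 x =
  g (x - n.+1%:R * P) + (periodization g P n x + g (x + n%:R * P)).
Proof.
rewrite /periodization addSn addnS big_ord_recl big_ord_recr /=; congr (_ + (_ + _)).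
- by rewrite sub0r mulNr.
- by apply: eq_bigr => i _; rewrite /bump leq0n add1n -!natr1; congr (g (_ + _ * _)); ring.
- by rewrite /bump leq0n add1n -!natr1 natrD; congr (g (_ + _ * _)); ring.
Qed.

Lemma periodization_split (V : nmodType) (g : R -> V) P (p q : nat) x : (p <= q)%N ->
  periodization g P q x = \sum_(j < p + q) g (x + (p%:R - 1 - j%:R) * P) +
                          \sum_(p <= n < q) g (x + n%:R * P).
Proof.
move=> pq; pose G i := g (x + (i%:R - q%:R) * P).
rewrite /periodization -(big_mkord xpredT G) (@big_cat_nat _ _ _ (p + q))//=; last first.
  by rewrite leq_add2r.
congr (_ + _).
- rewrite big_nat_rev big_mkord; apply: eq_bigr => j _; rewrite /G add0n natrB//.
  by rewrite natrD -[j.+1%:R]natr1; congr (g (_ + _ * _)); ring.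
- rewrite big_addn addnK; apply: eq_bigr => n _.
  by rewrite /G natrD addrK.
Qed.

Lemma continuous_periodization (g : R -> R) P n :
  continuous g -> continuous (periodization g P n).
Proof.
move=> cg; apply: continuous_bigsum => i x.
apply: continuous_comp; last exact: cg.
by apply: cvgD; [exact: cvg_id|exact: cvg_cst].
Qed.

Lemma cvg_Rintegral_periodization (k : R -> R) (P c : R) : 0 < P -> continuous k ->
  mu.-integrable setT (EFin \o k) ->
  \int[mu]_(x in `[c, c + P]) periodization k P n x @[n --> \oo] --> \int[mu]_x k x.
Proof.
move=> P0 ck ik; pose A (n : nat) : set R := `[c - n%:R * P, c + n%:R * P]%classic.
have Acover x : \forall n \near \oo, A n x.
  exists (Num.truncn (`|x - c| / P)).+1 => // n /= n_ge.
  rewrite /A /= in_itv/= -ler_distl -ler_pdivrMr//.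
  by apply: le_trans (ltW (truncnS_gt _)) _; rewrite ler_nat.
have mA n : measurable (A n) by exact: measurable_itv.
have := @cvg_Rintegral_exhaust _ _ R mu A k mA Acover ik.
apply: cvg_trans; apply: near_eq_cvg; apply: nearW => n; rewrite /A.
have -> : c + n%:R * P = c - n%:R * P + (n + n)%:R * P by rewrite natrD; ring.
rewrite Rintegral_cells// Rintegral_sum//; last first.
  move=> i; apply: integrable_continuous_itv => x.
  apply: continuous_comp; last exact: ck.
  by apply: cvgD; [exact: cvg_id|exact: cvg_cst].
apply: eq_bigr => i _; rewrite Rintegral_itv_shift ?lerDl ?ltW//.
have -> : c + (i%:R - n%:R) * P = c - n%:R * P + i%:R * P by ring.
by have -> : c + P + (i%:R - n%:R) * P = c - n%:R * P + i%:R * P + P by ring.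
Qed.

Lemma inv_sqr_le_telescope (n : nat) : (0 < n)%N ->
  (n%:R ^+ 2)^-1 <= 2 / n%:R - 2 / n.+1%:R :> R.
Proof.
move=> n0; have n1 : 1 <= n%:R :> R by rewrite ler1n.
rewrite -[n.+1%:R]natr1; set m : R := n%:R in n1 *.
have -> : 2 / m - 2 / (m + 1) = 2 / (m * (m + 1)) by field; lra.
rewrite -div1r ler_pdivrMr; last by rewrite exprn_gt0//; lra.
by rewrite mulrAC ler_pdivlMr; [rewrite expr2; nra|rewrite mulr_gt0; lra].
Qed.

Lemma periodization_cauchy (g : R -> R) (P C x : R) (n N : nat) : 0 < P ->
  quadratic_decay C (Num.norm \o g) ->
  (0 < n <= N)%N -> 2 * `|x| <= n%:R * P ->
  `|periodization g P N x - periodization g P n x| <= 16 * C / P ^+ 2 / n%:R.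
Proof.
move=> P0 gC /andP[n0 nN] xn.
have C0 := quadratic_decay_cst_ge0 (fun y => normr_ge0 (g y)) gC.
have decay y m : (0 < m)%N -> m%:R * P / 2 <= `|y| ->
    `|g y| <= 8 * C / P ^+ 2 * (m%:R ^+ 2)^-1 / 2.
  move=> m0 my; have -> : 8 * C / P ^+ 2 * (m%:R ^+ 2)^-1 / 2 = C / (m%:R * P / 2) ^+ 2.
    by field; rewrite !gt_eqF// ltr0n.
  by apply: (quadratic_decay_le C0 gC) => //; rewrite divr_gt0// mulr_gt0// ltr0n.
have C8 : 0 <= 8 * C / P ^+ 2 by rewrite divr_ge0 ?sqr_ge0// mulr_ge0.
suff : `|periodization g P N x - periodization g P n x| <=
    8 * C / P ^+ 2 * (2 / n%:R - 2 / N%:R).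
  move=> /le_trans; apply.
  have -> : 16 * C / P ^+ 2 / n%:R = 8 * C / P ^+ 2 * (2 / n%:R) by ring.
  by rewrite ler_wpM2l// gerBl divr_ge0.
elim: N nN => [|N IH]; first by rewrite leqNgt n0.
rewrite leq_eqVlt => /orP[/eqP <-|]; first by rewrite !subrr normr0 mulr0.
rewrite ltnS => nN; have N0 : (0 < N)%N by exact: leq_trans nN.
rewrite periodizationS.
set l := g (x - _); set r := g (x + _).
set hN := periodization _ _ N _; set hn := periodization _ _ n _.
have nNP : n%:R * P <= N%:R * P by rewrite ler_pM2r// ler_nat.
have l_le : `|l| <= 8 * C / P ^+ 2 * (N%:R ^+ 2)^-1 / 2.
  apply: decay => //; have := ler_norm x; have := ler_norm (- (x - N.+1%:R * P)).
  by rewrite normrN -[N.+1%:R]natr1; lra.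
have r_le : `|r| <= 8 * C / P ^+ 2 * (N%:R ^+ 2)^-1 / 2.
  apply: decay => //; have := ler_norm (- x); have := ler_norm (x + N%:R * P).
  by rewrite normrN; lra.
have -> : l + (hN + r) - hn = l + r + (hN - hn) by ring.
apply: le_trans (ler_normD _ _) _; apply: le_trans (lerD (ler_normD _ _) (IH nN)) _.
have := ler_wpM2l C8 (inv_sqr_le_telescope N0).
by move: l_le r_le; move: (2 / N.+1%:R) => w; lra.
Qed.

End Periodization.

(** * The Poisson summation formula for vanishing Fourier coefficients *)

Section Poisson.
Context {R : realType}.
Notation mu := (@lebesgue_measure R).
Implicit Types (g G phi : R -> R) (P C : R).

Definition periodic_orthogonal g P : Prop :=
  forall phi, circle_lipschitz phi -> \int[mu]_x (g x * phi (P^-1 * x)) = 0.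

Lemma circle_lipschitz_bounded phi : circle_lipschitz phi ->
  exists M, forall x, `|phi x| <= M.
Proof.
move=> [L L0 phiL]; exists (L * 2 + `|phi 0|) => x.
rewrite -[phi x](subrK (phi 0)) (le_trans (ler_normD _ _))// lerD2r.
apply: le_trans (phiL x 0) _; rewrite ler_wpM2l//.
by rewrite (le_trans (le_normcD _ _))// normcN !normc_cis -natr1.
Qed.

Lemma periodizationM g phi P n x : P != 0 -> circle_lipschitz phi ->
  periodization (fun y => g y * phi (P^-1 * y)) P n x =
  periodization g P n x * phi (P^-1 * x).
Proof.
move=> P0 lphi; rewrite /periodization mulr_suml; apply: eq_bigr => i _; congr (_ * _).
rewrite -(circle_lipschitz_nat _ n lphi) -[RHS](circle_lipschitz_nat _ i lphi).
by congr phi; field.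
Qed.

Lemma continuous_circle_lipschitzZ phi (w : R) : circle_lipschitz phi ->
  continuous (fun x => phi (w * x)).
Proof.
move=> lphi x; apply: continuous_comp; first exact: mulrl_continuous.
exact: continuous_circle_lipschitz.
Qed.

Lemma circle_bump G P x0 : 0 < P -> continuous G -> 0 < G x0 ->
  exists2 phi, circle_lipschitz phi & (forall x, 0 <= phi x) /\
    0 < \int[mu]_(x in `[x0 - P / 2, x0 - P / 2 + P]) (G x * phi (P^-1 * x)).
Proof.
move=> P0 cG G0; set cell := `[x0 - P / 2, x0 - P / 2 + P]%classic.
have [r r0 r_near] : exists2 r : R, 0 < r & forall x, `|x0 - x| < r -> 0 < G x.
  have /nbhs_ballP[r /= r0 G_gt0] : \forall x \near x0, 0 < G x.
    exact: cvgr_gt (cG x0) _ G0.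
  by exists r.
pose B := (fun x => P^-1 * x) @` (cell `&` ~` ball x0 r).
have cB : compact B.
  apply: continuous_compact; first exact/continuous_subspaceT/mulrl_continuous.
  apply: compact_closedI; first exact: segment_compact.
  by apply: open_closedC; exact: ball_open.
have [] := circle_urysohn (@compact_set1 _ (P^-1 * x0)) cB.
  move=> _ _ -> [x [/= xcell xr] <-]; apply: chord_gt0.
  rewrite -mulrBr normrM gtr0_norm ?invr_gt0// mulr_gt0 ?invr_gt0//=.
    rewrite mulrC ltr_pdivrMr// mul1r ltr_norml.
    by move: xcell; rewrite /cell /= in_itv/=; lra.
  by rewrite (lt_le_trans r0)// leNgt; apply/negP.
move=> phi lphi [phi01 phi1 phi0]; exists phi => //; split.
  by move=> x; case/andP: (phi01 x).
apply: (@Rintegral_itv_gt0 _ _ _ _ x0).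
- move=> x; apply: cvgM; first exact: cG.
  exact: continuous_circle_lipschitzZ.
- by lra.
- by rewrite phi1// mulr1.
- move=> x xcell; have [xr|xr] := ltP `|x0 - x| r.
    by rewrite mulr_ge0 ?(ltW (r_near _ xr))//; case/andP: (phi01 (P^-1 * x)).
  rewrite phi0 ?mulr0//; exists x => //; split; first by rewrite /cell/= in_itv.
  by move=> /= /lt_le_trans /(_ xr); rewrite ltxx.
Qed.

(* Otherwise the integrals over a period of [h_N phi], where [h_N] is the [N]-th partial
   periodization and [phi] is a bump at [x], stay away from their limit [\int g phi = 0]. *)
Lemma periodization_le_oscillation g P C x n (eps : R) : 0 < P -> continuous g ->
  quadratic_decay C (Num.norm \o g) -> periodic_orthogonal g P ->
  (forall N y, (n <= N)%N -> `|y - x| <= P / 2 ->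
    `|periodization g P N y - periodization g P n y| <= eps) ->
  periodization g P n x <= eps.
Proof.
move=> P0 cg gC g_orth osc; rewrite leNgt; apply/negP => eps_lt.
pose G y := periodization g P n y - eps.
have cG : continuous G.
  by move=> y; apply: cvgB; [exact: continuous_periodization|exact: cvg_cst].
have [] := @circle_bump G P x P0 cG; first by rewrite subr_gt0.
move=> phi lphi [phi0]; set I := (\int[mu]_(y in _) _) => I0.
have cphi := continuous_circle_lipschitzZ (w := P^-1) lphi.
pose k y := g y * phi (P^-1 * y).
have ck : continuous k by move=> y; apply: cvgM; [exact: cg|exact: cphi].
have [M phiM] := circle_lipschitz_bounded lphi.
have := cvg_Rintegral_periodization (x - P / 2) P0 ck
  (integrable_decayM cg cphi gC (fun y => phiM _)).
rewrite g_orth// => /cvgrPdist_lt /(_ _ I0)[N0 _ near_int].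
have := near_int (maxn N0 n) (leq_maxl _ _); rewrite sub0r normrN ltNge => /negP; apply.
apply: le_trans (ler_norm _); apply: le_Rintegral => //.
- by apply: integrable_continuous_itv => y; apply: cvgM; [exact: cG|exact: cphi].
- by apply: integrable_continuous_itv; exact: continuous_periodization.
move=> y /=; rewrite in_itv/= => ycell; rewrite periodizationM ?gt_eqF//.
apply: ler_wpM2r => //; rewrite /G.
have := osc (maxn N0 n) y (leq_maxr _ _); rewrite !ler_norml.
by lra.
Qed.

Lemma periodization_near_le g P C x (eps : R) : 0 < P -> continuous g ->
  quadratic_decay C (Num.norm \o g) -> periodic_orthogonal g P -> 0 < eps ->
  \forall n \near \oo, periodization g P n x <= eps.
Proof.
move=> P0 cg gC g_orth eps0.
have C0 := quadratic_decay_cst_ge0 (fun y => normr_ge0 (g y)) gC.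
have bC : 0 <= 16 * C / P ^+ 2 / eps by rewrite !divr_ge0 ?mulr_ge0 ?sqr_ge0// ltW.
have bx : 0 <= 2 * `|x| / P by rewrite divr_ge0 ?mulr_ge0// ltW.
exists (Num.truncn (16 * C / P ^+ 2 / eps + (2 * `|x| / P + 1))).+1 => // n /= n_ge.
have {}n_ge : 16 * C / P ^+ 2 / eps + (2 * `|x| / P + 1) <= n%:R.
  by apply: le_trans (ltW (truncnS_gt _)) _; rewrite ler_nat.
have n0 : (0 < n)%N by rewrite -(ltr_nat R); lra.
have nx : 2 * `|x| + P <= n%:R * P by rewrite -ler_pdivrMr// mulrDl divff ?gt_eqF//; lra.
apply: (periodization_le_oscillation P0 cg gC g_orth) => N y nN yx.
apply: le_trans (periodization_cauchy P0 gC _ _) _; first by rewrite n0.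
  rewrite -[y](subrK x); have := ler_normD (y - x) x; lra.
by rewrite ler_pdivrMr ?ltr0n// [eps * _]mulrC -ler_pdivrMr//; lra.
Qed.

Lemma periodization_bound g P C x n : 0 < P -> continuous g ->
  quadratic_decay C (Num.norm \o g) -> periodic_orthogonal g P ->
  (0 < n)%N -> 2 * `|x| <= n%:R * P ->
  `|periodization g P n x| <= 16 * C / P ^+ 2 / n%:R.
Proof.
move=> P0 cg gC g_orth n0 xn; apply/ler_addgt0Pr => eps eps0.
have gN : quadratic_decay C (Num.norm \o (fun y => - g y)).
  by move=> y; rewrite /= normrN; exact: gC.
have gN_orth : periodic_orthogonal (fun y => - g y) P.
  move=> phi lphi; under eq_Rintegral do rewrite mulNr -mulN1r.
  have [M phiM] := circle_lipschitz_bounded lphi.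
  rewrite RintegralZl ?g_orth ?mulr0//.
  apply: integrable_decayM cg _ gC (fun y => phiM _).
  exact: continuous_circle_lipschitzZ.
have cgN : continuous (fun y => - g y) by move=> y; apply: cvgN; exact: cg.
have [N _ near_le] := filterI (periodization_near_le x P0 cg gC g_orth eps0)
  (periodization_near_le x P0 cgN gN gN_orth eps0).
have [leN] := near_le (maxn N n) (leq_maxl _ _).
rewrite [X in X <= _]sumrN -/(periodization _ _ _ _) => leNN.
have := @periodization_cauchy _ g P C x n (maxn N n) P0 gC.
rewrite n0 leq_maxr => /(_ isT xn).
by move: leN leNN; rewrite !ler_norml; lra.
Qed.

Lemma trig_orthogonal g P C : continuous g ->
  quadratic_decay C (Num.norm \o g) ->
  (forall p : {poly R[i]}, \int[mu]_x (g x * Re p.[cis (P^-1 * x)]) = 0) ->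
  periodic_orthogonal g P.
Proof.
move=> cg gC g_trig phi lphi.
have ig : mu.-integrable setT (EFin \o g) by exact: integrable_decay gC.
apply/eqP; rewrite -normr_le0; apply/ler_addgt0Pr => eps eps0; rewrite add0r.
set J := \int[mu]_x `|g x|; have J1 : 0 < J + 1 by rewrite ltr_wpDl ?Rintegral_ge0.
have eps' : 0 < eps / (J + 1) by exact: divr_gt0.
have [p p_approx] := trig_approx lphi eps'.
have cphi := continuous_circle_lipschitzZ (w := P^-1) lphi.
have cp := @continuous_Re_horner _ p P^-1.
have [M phiM] := circle_lipschitz_bounded lphi.
have iphi := integrable_decayM cg cphi gC (fun y => phiM _).
have pM y : `|Re p.[cis (P^-1 * y)]| <= eps / (J + 1) + M.
  rewrite -[Re _](subrK (phi (P^-1 * y))) (le_trans (ler_normD _ _))//.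
  by rewrite lerD ?p_approx ?phiM.
have ip := integrable_decayM cg cp gC pM.
rewrite -[X in `|X|]subr0 -(g_trig p) -RintegralB//.
apply: le_trans (le_normr_Rintegral _ _) _ => //.
  exact: (integrableB measurableT iphi ip).
apply: (@le_trans _ _ (\int[mu]_x (eps / (J + 1) * `|g x|))).
  apply: le_Rintegral => // [||x _].
  - exact: (integrable_norm (integrableB measurableT iphi ip)).
  - exact: (integrableZl measurableT _ (integrable_norm ig)).
  - by rewrite -mulrBr normrM mulrC ler_wpM2r// distrC p_approx.
rewrite RintegralZl//; last exact: integrable_norm.
by rewrite mulrAC ler_pdivrMr// ler_pM2l// lerDl.
Qed.

End Poisson.

Section FourierPoisson.
Context {R : realType}.
Notation mu := (@lebesgue_measure R).
Variables (f : R -> R[i]) (C : R).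
Hypotheses (cf : continuousC f) (fC : quadratic_decay C (fun x => normc (f x))).
Let u x := Re (f x).
Let v x := Im (f x).
Implicit Types (d : R[i]) (s t x : R).

Lemma Re_fourier_kernel d s x : Re (d * (f x * cis (- (s * x)))) =
  Re d * (u x * cos (2 * pi * s * x) + v x * sin (2 * pi * s * x))
  - Im d * (v x * cos (2 * pi * s * x) - u x * sin (2 * pi * s * x)).
Proof.
by rewrite ReM ImM ReM Re_cis Im_cis mulrN cosN sinN !mulrA /u /v; ring.
Qed.

Lemma fourier_kernel_decay d s :
  quadratic_decay (normc d * C) (fun x => `|Re (d * (f x * cis (- (s * x))))|).
Proof.
move=> x; apply: le_trans (normc_ge_Re _) _.
by rewrite !normcM normc_cis mulr1 -mulrA ler_wpM2l ?normc_ge0//; exact: fC.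
Qed.

Lemma continuous_fourier_kernel d s :
  continuous (fun x => Re (d * (f x * cis (- (s * x))))).
Proof.
suff [] : continuousC (fun x => d * (f x * cis (- (s * x)))) by [].
apply: continuousC_mul; first exact: continuousC_cst.
apply: continuousC_mul => //; under eq_fun do rewrite -mulNr.
exact: continuousC_cis_mull.
Qed.

Lemma integrable_fourier_kernel d s :
  mu.-integrable setT (EFin \o (fun x => Re (d * (f x * cis (- (s * x)))))).
Proof.
exact: integrable_decay (@continuous_fourier_kernel d s) (fourier_kernel_decay d s).
Qed.

Lemma Rintegral_fourier_kernel d s :
  \int[mu]_x Re (d * (f x * cis (- (s * x)))) =
  Re d * fourier_re u v s - Im d * fourier_im u v s.
Proof.
have reE x : Re (1 * (f x * cis (- (s * x)))) =
    u x * cos (2 * pi * s * x) + v x * sin (2 * pi * s * x).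
  by rewrite Re_fourier_kernel /= mul1r mul0r subr0.
have imE x : Re ((0 -i* 1)%C * (f x * cis (- (s * x)))) =
    v x * cos (2 * pi * s * x) - u x * sin (2 * pi * s * x).
  by rewrite Re_fourier_kernel /= mul0r mulNr mul1r opprK add0r.
have ire := integrable_fourier_kernel 1 s; rewrite (funext reE) in ire.
have iim := integrable_fourier_kernel (0 -i* 1)%C s; rewrite (funext imE) in iim.
under eq_Rintegral do rewrite Re_fourier_kernel.
rewrite RintegralB//=; [by rewrite !RintegralZl|exact: (integrableZl measurableT _ ire)
  |exact: (integrableZl measurableT _ iim)].
Qed.

Lemma fourier_kernel_trigE d (p : {poly R[i]}) a t x :
  Re (d * (f x * cis (- (t * x)))) * Re p.[cis (a * x)] = 2^-1 *
    \sum_(i < size p)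
      (Re (d * p`_i * (f x * cis (- ((t + (- i%:Z)%:~R * a) * x)))) +
       Re (d * (p`_i)^*%C * (f x * cis (- ((t + i%:Z%:~R * a) * x))))).
Proof.
have ReMRe (z w : R[i]) : Re z * Re w = 2^-1 * (Re (z * w) + Re (z * w^*%C)).
  by case: z w => ? ? [? ?] /=; field.
rewrite horner_coef Re_sum !mulr_sumr; apply: eq_bigr => i _; rewrite ReMRe.
rewrite -cisMn rmorphM /= -cisN; congr (_ * (Re _ + Re _)).
- rewrite mulrACA -[f x * _ * _]mulrA -cisD; congr (_ * (_ * cis _)).
  by rewrite mulrNz -pmulrn; ring.
- rewrite mulrACA -[f x * _ * _]mulrA -cisD; congr (_ * (_ * cis _)).
  by rewrite -pmulrn; ring.
Qed.

Variables (a t : R).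
Hypothesis (a0 : 0 < a).
Hypothesis fourier0 : forall k : int,
  fourier_re u v (t + k%:~R * a) = 0 /\ fourier_im u v (t + k%:~R * a) = 0.

Lemma Rintegral_fourier_kernel_trig d (p : {poly R[i]}) :
  \int[mu]_x (Re (d * (f x * cis (- (t * x)))) * Re p.[cis (a * x)]) = 0.
Proof.
have kernel0 c (k : int) : \int[mu]_x Re (c * (f x * cis (- ((t + k%:~R * a) * x)))) = 0.
  by rewrite Rintegral_fourier_kernel; have [-> ->] := fourier0 k; rewrite !mulr0 subrr.
pose F i x := Re (d * p`_i * (f x * cis (- ((t + (- i%:Z)%:~R * a) * x)))) +
  Re (d * (p`_i)^*%C * (f x * cis (- ((t + i%:Z%:~R * a) * x)))).
have iF i : mu.-integrable setT (EFin \o F i).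
  exact: (integrableD measurableT (integrable_fourier_kernel _ _)
                                  (integrable_fourier_kernel _ _)).
under eq_Rintegral do rewrite fourier_kernel_trigE.
rewrite RintegralZl//; last by apply: integrable_sum_EFin => // i; exact: iF.
rewrite Rintegral_sum//; last by move=> i; exact: iF.
rewrite big1 ?mulr0// => i _.
rewrite RintegralD ?kernel0 ?addr0//; exact: integrable_fourier_kernel.
Qed.

Lemma normc_periodization_le n x : (0 < n)%N -> 2 * a * `|x| <= n%:R ->
  normc (periodization (fun y => f y * cis (- (t * y))) a^-1 n x) <=
    16 * C * a ^+ 2 / n%:R.
Proof.
move=> n0 xn; set Z := periodization _ _ _ _; have [c c1 <-] := normc_phase Z.
pose g y := Re (c * (f y * cis (- (t * y)))).
have gC : quadratic_decay C (Num.norm \o g).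
  by have := fourier_kernel_decay c t; rewrite c1 mul1r.
have cg : continuous g by exact: continuous_fourier_kernel.
have -> : Re (c * Z) = periodization g a^-1 n x by rewrite mulr_sumr Re_sum.
apply: le_trans (ler_norm _) _.
have -> : 16 * C * a ^+ 2 = 16 * C / a^-1 ^+ 2 by rewrite exprVn invrK.
apply: periodization_bound => //; first by rewrite invr_gt0.
  apply: (@trig_orthogonal _ _ _ C) => // p; rewrite invrK.
  exact: Rintegral_fourier_kernel_trig.
by rewrite ler_pdivlMr// mulrAC.
Qed.

End FourierPoisson.

(** * Polynomials small on a set of positive measure *)

Section TrigonometricPolynomials.
Context {R : realType}.
Notation mu := (@lebesgue_measure R).
Implicit Types (p B : {poly R[i]}) (w P : R).

Lemma normc_horner_cis p (x : R) : normc p.[cis x] <= \sum_(i < size p) normc p`_i.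
Proof.
rewrite horner_coef; apply: le_trans (normc_sum _ _ _) _.
by apply: ler_sum => i _; rewrite normcM normcX normc_cis expr1n mulr1.
Qed.

Lemma continuous_Re_cis (z : R[i]) w : continuous (fun x => Re (z * cis (w * x))).
Proof.
by have [] := continuousC_mul (continuousC_cst z) (continuousC_cis_mull w).
Qed.

Lemma normc_drop_poly1 p (x : R) :
  normc (drop_poly 1 p).[cis x] <= normc p.[cis x] + normc p`_0.
Proof.
have dropE : p.[cis x] - p`_0 = (drop_poly 1 p).[cis x] * cis x.
  have take1 : take_poly 1 p = (p`_0)%:P.
    by apply/polyP => -[|i]; rewrite coef_take_poly coefC.
  rewrite -{1}(poly_take_drop 1 p) hornerD hornerM hornerXn expr1.
  by rewrite take1 hornerC addrC addKr.
rewrite -[leLHS]mulr1 -(normc_cis x) -normcM -dropE.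
by apply: le_trans (le_normcD _ _) _; rewrite normcN.
Qed.

Lemma is_derive_Re_cis (z : R[i]) w (x : R) :
  is_derive x 1 (fun y => Re (z * cis (w * y))) (- (2 * pi * w) * Im (z * cis (w * x))).
Proof.
under eq_fun do rewrite ReM Re_cis Im_cis mulrA.
have dlin : is_derive x 1 (fun y : R => 2 * pi * w * y) (2 * pi * w).
  have did := is_deriveZ (2 * pi * w) (is_derive_id x (1 : R)).
  by apply: (@is_derive_eq _ _ _ _ _ _ _ _ did); rewrite /GRing.scale/= mulr1.
have dcos := is_deriveZ (Re z) (is_derive1_comp (is_derive_cos _) dlin).
have dsin := is_deriveZ (Im z) (is_derive1_comp (is_derive_sin _) dlin).
apply: (@is_derive_eq _ _ _ _ _ _ _ _ (is_deriveB dcos dsin)).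
by rewrite ImM Re_cis Im_cis /GRing.scale/= !mulrA; ring.
Qed.

Lemma Rintegral_cis_period (z : R[i]) P (n : nat) : 0 < P -> (0 < n)%N ->
  \int[mu]_(x in `[0, P]) Re (z * cis (n%:R / P * x)) = 0.
Proof.
move=> P0 n0; set w := n%:R / P; pose W : R := 2 * pi * w.
have w0 : w != 0 by rewrite gt_eqF// divr_gt0// ltr0n.
have W0 : W != 0 by apply: mulf_neq0 => //; rewrite mulf_neq0// gt_eqF// pi_gt0.
pose primitive x := Re ((W^-1)%:C%C * (0 -i* 1)%C * z * cis (w * x)).
have dprim (x : R) : is_derive x 1 primitive (Re (z * cis (w * x))).
  apply: (is_derive_eq (is_derive_Re_cis _ _ _)); rewrite -/W -!mulrA ImM /=.
  by move: (z * _) => z'; rewrite ImM /=; field.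
have cprim : continuous primitive.
  by move=> x; apply/differentiable_continuous/derivable1_diffP; exact: ex_derive.
rewrite /Rintegral (@continuous_FTC2 _ _ primitive); first last.
- by move=> x _; rewrite derive1E; exact: derive_val.
- split=> [x _||]; first exact: ex_derive.
  + exact/cvg_at_right_filter/cprim.
  + exact/cvg_at_left_filter/cprim.
- exact/continuous_subspaceT/continuous_Re_cis.
- by [].
by rewrite -EFinB/= /primitive /w mulfVK ?gt_eqF// mulr0 cis0 cis_nat subrr.
Qed.

Lemma Rintegral_Re_horner p P : 0 < P ->
  \int[mu]_(x in `[0, P]) Re p.[cis (P^-1 * x)] = P * Re p`_0.
Proof.
move=> P0.
have E x : Re p.[cis (P^-1 * x)] = \sum_(i < size p) Re (p`_i * cis (i%:R / P * x)).
  by rewrite horner_coef Re_sum; apply: eq_bigr => i _; rewrite -cisMn mulrA.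
under eq_Rintegral do rewrite E.
rewrite Rintegral_sum//; last first.
  by move=> i; apply: integrable_continuous_itv; exact: continuous_Re_cis.
case sz: (size p) => [|n].
  by rewrite big_ord0 nth_default ?sz// mulr0.
rewrite big_ord_recl/= [X in _ + X]big1 ?addr0.
  under eq_Rintegral do rewrite mul0r mul0r cis0 mulr1.
  by rewrite Rintegral_itv_cst ?ltW// subr0 mulrC.
by move=> i _; exact: Rintegral_cis_period.
Qed.

Lemma normc_pow_le_exp (z : R[i]) (n : nat) : (0 < n)%N ->
  normc ((1 + z * (n%:R^-1)%:C%C) ^+ n) <= expR (Re z + normc z ^+ 2 / (2 * n%:R)).
Proof.
move=> n0; have nn : 0 < n%:R :> R by rewrite ltr0n.
set w := z * _; rewrite normcX.
have -> : Re z + normc z ^+ 2 / (2 * n%:R) = (Re w + normc w ^+ 2 / 2) * n%:R.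
  rewrite /w normcM ReM /= !mulr0 subr0 expr0n addr0 sqrtr_sqr.
  by rewrite ger0_norm ?invr_ge0//; field; rewrite gt_eqF.
rewrite expRM_natr lerXn2r ?nnegrE ?normc_ge0 ?expR_ge0//.
rewrite -(@ler_pXn2r _ 2) ?nnegrE ?normc_ge0 ?expR_ge0//.
rewrite -expRM_natl; apply: le_trans (expR_ge1Dx _).
by rewrite !sqr_normcE; case: w => x y /=; rewrite add0r; lra.
Qed.

Lemma expR_affine_small (c y : R) : 0 < c -> 0 < y ->
  exists2 lam : R, 0 <= lam & expR (1 - lam * c) <= y.
Proof.
move=> c0 y0; exists (`|1 - ln y| / c); first by rewrite divr_ge0// ltW.
rewrite mulfVK ?gt_eqF// -[leRHS](@lnK R) ?posrE// ler_expR.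
by have := ler_norm (1 - ln y); lra.
Qed.

(* [(1 + B / N) ^ N] approximates [exp B]. *)
Lemma poly_le_expR B : B`_0 = 0 -> exists2 Q : {poly R[i]}, Q`_0 = 1 &
  forall x, normc Q.[cis x] <= expR (Re B.[cis x] + 1).
Proof.
move=> B0; pose M := \sum_(i < size B) normc B`_i.
pose N := (Num.truncn (M ^+ 2)).+1.
have N0 : 0 < N%:R :> R by rewrite ltr0n.
exists ((1 + B * (N%:R^-1)%:C%C%:P) ^+ N).
  rewrite -horner_coef0 horner_exp hornerD hornerM [B.[0]]horner_coef0 B0.
  by rewrite mul0r addr0 hornerE expr1n.
move=> x; rewrite horner_exp hornerD hornerM !hornerC.
apply: le_trans (normc_pow_le_exp _ _) _ => //.
rewrite ler_expR lerD2l ler_pdivrMr ?mulr_gt0// mul1r.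
apply: (@le_trans _ _ (M ^+ 2)).
  rewrite lerXn2r ?nnegrE ?normc_ge0//; last exact: normc_horner_cis.
  by apply: sumr_ge0 => i _; exact: normc_ge0.
apply: (@le_trans _ _ N%:R); first exact/ltW/truncnS_gt.
by rewrite ler_peMl ?(ltW N0)// ler1n.
Qed.

End TrigonometricPolynomials.

Section SmallCoefficients.
Context {R : realType}.
Notation mu := (@lebesgue_measure R).
Variables (a : R) (K : set R).
Hypotheses (a0 : 0 < a) (cK : compact K) (Ka : K `<=` `[0, a[).
Hypothesis muK_gt0 : (0 < mu K)%E.
Implicit Types (A : set R) (h : R -> R).
Let circle : set R := `[0, a[%classic.
Let e (x : R) : R[i] := cis (a^-1 * x).

Let mK : measurable K. Proof. exact: compact_measurable. Qed.

Let mU : measurable (circle `\` K).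
Proof. by apply: measurableD => //; exact: measurable_itv. Qed.

Let mu_sub A : measurable A -> A `<=` circle ->
  (mu A < +oo)%E /\ 0 <= fine (mu A) <= a.
Proof.
move=> mA Aa; have le_a : (mu A <= a%:E)%E.
  rewrite -(lebesgue_measure_period a0).
  by apply: le_measure; rewrite ?inE//; exact: measurable_itv.
have Aoo : (mu A < +oo)%E by rewrite (le_lt_trans le_a)// ltry.
by rewrite fine_ge0// -lee_fin fineK// ge0_fin_numE.
Qed.

Let integrable_sub A h : measurable A -> A `<=` circle -> continuous h ->
  mu.-integrable A (EFin \o h).
Proof.
move=> mA Aa ch; apply: (@integrableS _ _ _ mu `[0, a]%classic A) => //.
- by move=> x /Aa; apply: subset_itvl; rewrite bnd_simp.
- exact: integrable_continuous_itv.
Qed.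

Let density : R := fine (mu K) / a.

Let density_gt0 : 0 < density.
Proof.
have [Koo _] := mu_sub mK Ka.
by rewrite divr_gt0// fine_gt0// muK_gt0 Koo.
Qed.

Lemma Rintegral_circle_setD h : continuous h ->
  \int[mu]_(x in `[0, a]) h x =
  \int[mu]_(x in K) h x + \int[mu]_(x in circle `\` K) h x.
Proof.
move=> ch; rewrite -Rintegral_itv_bndo_bndc; last exact: integrable_sub.
by apply: Rintegral_setD => //; exact: integrable_sub.
Qed.

Lemma Re_coef0_ge (p : {poly R[i]}) (r : R) :
  (forall x, K x -> 1 - r <= Re p.[e x]) -> (forall x, - r <= Re p.[e x]) ->
  density - r <= Re p`_0.
Proof.
move=> pK pU; have cp : continuous (fun x => Re p.[e x]) by exact: continuous_Re_horner.
have [Koo _] := mu_sub mK Ka.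
have [Uoo _] := mu_sub mU (@subDsetl _ _ _).
have massE : fine (mu K) + fine (mu (circle `\` K)) = a.
  have := @Rintegral_circle_setD (fun=> 1) (fun x => cvg_cst _).
  by rewrite Rintegral_itv_cst ?(ltW a0)// !Rintegral_cst// !mul1r subr0 => ->.
have intK : (1 - r) * fine (mu K) <= \int[mu]_(x in K) Re p.[e x].
  by apply: Rintegral_ge_cst => //; exact: integrable_sub.
have intU : - r * fine (mu (circle `\` K)) <= \int[mu]_(x in circle `\` K) Re p.[e x].
  by apply: Rintegral_ge_cst => //; apply: integrable_sub => // x [].
rewrite -(ler_pM2l a0) -Rintegral_Re_horner// Rintegral_circle_setD//.
apply: le_trans (lerD intK intU).
have -> : a * (density - r) = fine (mu K) - r * a.
  by rewrite /density; field; rewrite gt_eqF.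
by rewrite -massE; lra.
Qed.

(* [B] approximates the indicator function of [K] minus its mean. *)
Lemma indicator_poly (eps : R) : 0 < eps ->
  exists K' (B : {poly R[i]}), [/\ compact K', K' `<=` circle `\` K,
    (mu ((circle `\` K) `\` K') < eps%:E)%E & B`_0 = 0 /\
    forall x, Re B.[e x] <= 1 /\ (K' x -> Re B.[e x] <= - (density / 2))].
Proof.
move=> eps0; have Usub : circle `\` K `<=` circle by move=> x [].
have [Uoo _] := mu_sub mU Usub.
have [K' [cK' K'U UK'lt]] := lebesgue_regularity_inner mU Uoo eps0.
pose scale (A : set R) := (fun x => a^-1 * x) @` A.
have cscale A : compact A -> compact (scale A).
  by apply: continuous_compact; exact/continuous_subspaceT/mulrl_continuous.
have [_ _ [x Kx <-] [y K'y <-]|phi lphi [phi01 phi1 phi0]] :=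
    circle_urysohn (cscale _ cK) (cscale _ cK').
  apply: chord_gt0; rewrite -mulrBr normrM gtr0_norm ?invr_gt0//.
  have [/= + nKy] := K'U _ K'y; have := Ka Kx; rewrite /circle /= !in_itv/= => xa ya.
  rewrite mulr_gt0 ?invr_gt0//=; last first.
    by rewrite normr_gt0 subr_eq0; apply: contra_not_neq nKy => <-.
  by rewrite mulrC ltr_pdivrMr// mul1r ltr_norml; lra.
have [A phiA] := trig_approx lphi (divr_gt0 density_gt0 (ltr0n _ 4 : 0 < 4%:R)).
have {}phiA x : `|Re A.[e x] - phi (a^-1 * x)| <= density / 4 by exact: phiA.
have mean : 3 / 4 * density <= Re A`_0.
  have -> : 3 / 4 * density = density - density / 4 by field.
  apply: Re_coef0_ge => x.
  - by move=> Kx; have := phiA x; rewrite phi1 ?ler_norml; [lra|exists x].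
  - by have := phiA x; have := phi01 (a^-1 * x); rewrite ler_norml; lra.
exists K', (A - (A`_0)%:P); split=> //; split=> [|x].
  by rewrite coefB coefC subrr.
rewrite hornerD hornerN hornerC [Re _](raddfB (@Re R : Rcomplex R -> R)).
have := phiA x; have := phi01 (a^-1 * x); rewrite ler_norml => phix approx; split.
  by lra.
by move=> K'x; move: approx; rewrite phi0; [lra|exists x].
Qed.

Lemma normc_poly_small_outside (eta : R) : 0 < eta -> exists2 Q : {poly R[i]}, Q`_0 = 1 &
  \int[mu]_(x in circle `\` K) normc Q.[e x] <= eta.
Proof.
move=> eta0.
have eta_a : 0 < eta / (2 * a) by rewrite divr_gt0// mulr_gt0.
have half_density : 0 < density / 2 by rewrite divr_gt0.
have [lam lam0 exp_lam] := expR_affine_small half_density eta_a.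
have kap0 : 0 < eta / (2 * expR (1 + lam)) by rewrite divr_gt0// mulr_gt0// expR_gt0.
have [K' [B [cK' K'U small [B0 ReB]]]] := indicator_poly kap0.
have [Q Q0 Q_le] : exists2 Q : {poly R[i]}, Q`_0 = 1 &
    forall x, normc Q.[cis x] <= expR (lam * Re B.[cis x] + 1).
  have [|Q Q0 Q_le] := @poly_le_expR _ (lam%:C%C *: B); first by rewrite coefZ B0 mulr0.
  by exists Q => // x; rewrite -ReMr -hornerZ.
exists Q => //.
have mK' := compact_measurable cK'.
have mV : measurable ((circle `\` K) `\` K') by exact: measurableD.
have Vsub : (circle `\` K) `\` K' `<=` circle by move=> x [[]].
have K'sub : K' `<=` circle by move=> x /K'U[].
have cQ : continuous (fun x => normc Q.[e x]) by exact: continuous_normc_horner.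
have [K'oo /andP[_ muK'a]] := mu_sub mK' K'sub.
have [Voo _] := mu_sub mV Vsub.
have intK' : \int[mu]_(x in K') normc Q.[e x] <= eta / (2 * a) * fine (mu K').
  apply: Rintegral_le_cst => // [|x K'x]; first exact: integrable_sub.
  apply: le_trans (Q_le _) _; apply: le_trans exp_lam.
  rewrite ler_expR addrC lerD2l -mulrN ler_wpM2l//.
  by have [_ /(_ K'x)] := ReB x.
have intV : \int[mu]_(x in (circle `\` K) `\` K') normc Q.[e x] <=
    expR (1 + lam) * fine (mu ((circle `\` K) `\` K')).
  apply: Rintegral_le_cst => // [|x _]; first exact: integrable_sub.
  apply: le_trans (Q_le _) _; rewrite ler_expR addrC lerD2l.
  by rewrite ler_piMr//; have [] := ReB x.
rewrite (@Rintegral_setD _ _ R mu _ _ _ mK' mU K'U); last first.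
  by apply: integrable_sub => // x [].
apply: le_trans (lerD intK' intV) _; rewrite [leRHS]splitr; apply: lerD.
  have -> : eta / 2 = eta / (2 * a) * a by field; rewrite gt_eqF.
  by rewrite ler_wpM2l// divr_ge0 ?mulr_ge0// ltW.
have -> : eta / 2 = expR (1 + lam) * (eta / (2 * expR (1 + lam))).
  by field; rewrite gt_eqF ?expR_gt0.
rewrite ler_wpM2l ?expR_ge0// -lee_fin fineK ?ltW//.
by rewrite ge0_fin_numE.
Qed.

Lemma normc_coef0_le (p Q : {poly R[i]}) : Q`_0 = 1 ->
  a * normc p`_0 <= \int[mu]_(x in K) (normc p.[e x] * normc Q.[e x]) +
                    \int[mu]_(x in circle `\` K) (normc p.[e x] * normc Q.[e x]).
Proof.
move=> Q0; have [c c1 cp] := normc_phase p`_0.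
have cpQ : continuous (fun x => normc p.[e x] * normc Q.[e x]).
  by move=> x; apply: cvgM; exact: continuous_normc_horner.
have <- : Re (c *: (p * Q))`_0 = normc p`_0 by rewrite coefZ coef0M Q0 mulr1.
rewrite -Rintegral_Re_horner// -Rintegral_circle_setD//; apply: le_Rintegral => //.
- by apply: integrable_continuous_itv; exact: continuous_Re_horner.
- exact: integrable_continuous_itv.
- move=> x _; apply: le_trans (le_trans (ler_norm _) (normc_ge_Re _)) _.
  by rewrite hornerZ hornerM !normcM c1 mul1r.
Qed.

Lemma const_coef_small (M eta : R) : 0 < M -> 0 < eta ->
  exists2 eps : R, 0 < eps & forall p : {poly R[i]},
    (forall x, normc p.[cis x] <= M) -> (forall x, K x -> normc p.[e x] <= eps) ->
    normc p`_0 <= eta.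
Proof.
move=> M0 eta0.
have eta' : 0 < a * eta / (2 * M) by rewrite divr_gt0 ?mulr_gt0.
have [Q Q0 Q_int] := normc_poly_small_outside eta'.
pose B := \sum_(i < size Q) normc Q`_i + 1.
have B0 : 0 < B by rewrite ltr_wpDl// sumr_ge0// => i _; exact: normc_ge0.
have QB x : normc Q.[cis x] <= B.
  by apply: le_trans (normc_horner_cis _ _) _; rewrite lerDl.
exists (eta / (2 * B)) => [|p pM pK]; first by rewrite divr_gt0// mulr_gt0.
have cQ : continuous (fun x => normc Q.[e x]) by exact: continuous_normc_horner.
have cpQ : continuous (fun x => normc p.[e x] * normc Q.[e x]).
  by move=> x; apply: cvgM; exact: continuous_normc_horner.
have [Koo /andP[_ muKa]] := mu_sub mK Ka.
rewrite -(ler_pM2l a0); apply: le_trans (normc_coef0_le p Q0) _.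
rewrite [leRHS](_ : _ = eta / 2 * a + M * (a * eta / (2 * M))); last first.
  by field; rewrite gt_eqF.
apply: lerD.
  apply: (@le_trans _ _ (eta / 2 * fine (mu K))); last first.
    by rewrite ler_wpM2l// ltW// divr_gt0.
  apply: Rintegral_le_cst => // [|x Kx]; first exact: integrable_sub.
  have -> : eta / 2 = eta / (2 * B) * B by field; rewrite gt_eqF.
  by apply: ler_pM; rewrite ?normc_ge0 ?pK ?QB.
apply: le_trans (ler_wpM2l (ltW M0) Q_int); rewrite -RintegralZl//; last first.
  by apply: integrable_sub => // x [].
apply: le_Rintegral => // [||x _].
- by apply: integrable_sub => // x [].
- apply: integrable_sub => // x.
  by apply: cvgM; [exact: cvg_cst|exact: cQ].
- by apply: ler_wpM2r; [exact: normc_ge0|exact: pM].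
Qed.

(* Peel off the constant coefficient, which is small, and divide by the variable. *)
Lemma coefs_small (M eta : R) (n : nat) : 0 < M -> 0 < eta ->
  exists2 eps : R, 0 < eps & forall p : {poly R[i]},
    (forall x, normc p.[cis x] <= M) -> (forall x, K x -> normc p.[e x] <= eps) ->
    forall k, (k < n)%N -> normc p`_k <= eta.
Proof.
elim: n M eta => [|n IH] M eta M0 eta0; first by exists 1.
have M2 : 0 < 2 * M by rewrite mulr_gt0.
have [eps1 eps1_gt0 tail_small] := IH (2 * M) eta M2 eta0.
have min0 : 0 < Num.min (Num.min M eta) (eps1 / 2) by rewrite !lt_min M0 eta0 divr_gt0.
have [eps0 eps0_gt0 const_small] := const_coef_small M0 min0.
exists (Num.min eps0 (eps1 / 2)); first by rewrite lt_min eps0_gt0 divr_gt0.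
move=> p pM pK.
have : normc p`_0 <= Num.min (Num.min M eta) (eps1 / 2).
  by apply: const_small => // x /pK; rewrite le_min => /andP[].
rewrite !le_min -andbA => /and3P[p0M p0eta p0eps].
case=> [//|k]; rewrite ltnS => kn.
have -> : p`_k.+1 = (drop_poly 1 p)`_k by rewrite coef_drop_poly addn1.
apply: tail_small kn => [x|x Kx]; apply: le_trans (normc_drop_poly1 _ _) _.
  by have := pM x; lra.
by have := pK x Kx; rewrite le_min => /andP[_]; rewrite /e; lra.
Qed.

End SmallCoefficients.

(** * Compact sets of positive measure *)

Section CompactDisjoint.
Context {R : realType}.
Notation mu := (@lebesgue_measure R).

Lemma compact_disjoint_positive (D G : set R) :
  measurable D -> (mu D < +oo)%E -> (leb G < mu D)%E ->
  exists K : set R, [/\ compact K, K `<=` D, (0 < mu K)%E & K `&` G = set0].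
Proof.
move=> mD Doo GD.
have [V [mV GV VD]] : exists V : set R, [/\ measurable V, G `<=` V & (mu V < mu D)%E].
  have /ereal_inf_lt[_ [A [mA GA] <-] A_lt] : (leb G < mu D)%E := GD.
  exists (\bigcup_k A k); split=> //.
    by apply: bigcupT_measurable => k; apply: sub_sigma_algebra; exact: mA.
  by apply: le_lt_trans A_lt; apply: ereal_inf_lbound; exists A => //; split.
have mDV : measurable (D `\` V) by exact: measurableD.
have DVoo : (mu (D `\` V) < +oo)%E.
  by apply: le_lt_trans Doo; apply: le_measure; rewrite ?inE//; exact: subDsetl.
have DV_gt0 : (0 < mu (D `\` V))%E.
  rewrite measureD// sube_gt0; apply: le_lt_trans VD.
  by apply: le_measure; rewrite ?inE//; exact: measurableI.
have fineDV : 0 < fine (mu (D `\` V)) by rewrite fine_gt0// DV_gt0.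
have [K [cK KDV small]] := lebesgue_regularity_inner mDV DVoo fineDV.
have mK := compact_measurable cK.
exists K; split=> //; first by move=> x /KDV[].
- rewrite lt_neqAle measure_ge0 andbT; apply/eqP => K0; move: small.
  rewrite fineK ?ge0_fin_numE// measureD// setIidr//.
  by rewrite -[X in (_ - X)%E]K0 sube0 ltxx.
- by rewrite -subset0 => x [/KDV[_ nVx] /GV].
Qed.

End CompactDisjoint.

(** * Sequences of nodes and their density *)

Lemma int_upward_closed (P : pred int) : (exists m, ~~ P m) -> (exists m, P m) ->
  (forall m n, m <= n -> P m -> P n) -> exists n, forall m, P m = (n <= m).
Proof.
move=> [m0 Pm0] [m1 Pm1] upP.
have Pex : exists k : nat, P (m0 + k%:Z).
  have m01 : m0 <= m1 by rewrite leNgt; apply: contra Pm0 => /ltW/upP; exact.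
  by exists `|m1 - m0|%N; rewrite gez0_abs ?subr_ge0// subrKC.
have [k Pk kmin] := ex_minnP Pex; exists (m0 + k%:Z) => m.
have [/upP|mk] := leP (m0 + k%:Z) m; first exact.
apply/negP => Pm; have m0m : m0 <= m.
  by rewrite leNgt; apply: contra Pm0 => /ltW/upP; exact.
have := kmin `|m - m0|%N; rewrite gez0_abs ?subr_ge0// subrKC => /(_ Pm).
by move: m0m mk; lia.
Qed.

Section Density.
Context {R : realType}.
Variable (lambda : int -> R).

Lemma uniformly_discrete_range (delta : R) : 0 < delta ->
  (forall m n, m < n -> lambda m + delta <= lambda n) -> uniformly_discrete (range lambda).
Proof.
move=> d0 gap; exists delta; split=> // _ _ [m _ <-] [n _ <-] mn.
have [/gap|/gap|mn'] := ltgtP m n; last by rewrite mn' eqxx in mn.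
- by have := ler_norm (lambda n - lambda m); rewrite distrC; lra.
- by have := ler_norm (lambda m - lambda n); lra.
Qed.

Definition asymptotic_slope (s : R) : Prop :=
  forall eps : R, 0 < eps -> exists2 C : R, 0 <= C &
    forall n (k : nat), `|lambda (n + k%:Z) - lambda n - k%:R * s| <= C + eps * k%:R.

Variable (a : R).
Hypothesis a0 : 0 < a.
Hypothesis lambda_incr : {homo lambda : m n / m < n}.
Hypothesis lambda_slope : asymptotic_slope a^-1.

Lemma range_unbounded (y : R) : (exists n, lambda n < y) /\ (exists n, y < lambda n).
Proof.
have e0 : 0 < (2 * a)^-1 by rewrite invr_gt0 mulr_gt0.
have [C C0 lin] := lambda_slope e0.
pose k := (Num.truncn (2 * a * (C + `|y - lambda 0|))).+1.
have k_gt : C + `|y - lambda 0| < k%:R / a - (2 * a)^-1 * k%:R.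
  have -> : k%:R / a - (2 * a)^-1 * k%:R = k%:R / (2 * a) by field; rewrite gt_eqF.
  by rewrite ltr_pdivlMr ?mulr_gt0// mulrC truncnS_gt.
have := ler_norm (y - lambda 0); have := ler_norm (lambda 0 - y); rewrite distrC => lo hi.
split; [exists (- k%:Z)|exists (0 + k%:Z)].
- by have := lin (- k%:Z) k; rewrite addNr ler_norml; lra.
- by have := lin 0 k; rewrite ler_norml; lra.
Qed.

Lemma range_itv (x y : R) : exists A B : int, [/\ forall n, (x < lambda n) = (A <= n),
  forall n, (y <= lambda n) = (B <= n) & x < y -> A <= B].
Proof.
have le_lambda : {mono lambda : m n / m <= n} by exact: le_mono.
have [] := @int_upward_closed [pred n | x < lambda n] => [|||A Adef].
- by have [[n nx] _] := range_unbounded x; exists n; rewrite /= -leNgt ltW.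
- by have [_ [n xn]] := range_unbounded x; exists n.
- by move=> m n mn /lt_le_trans; apply; rewrite le_lambda.
have [] := @int_upward_closed [pred n | y <= lambda n] => [|||B Bdef].
- by have [[n ny] _] := range_unbounded y; exists n; rewrite /= -ltNge.
- by have [_ [n yn]] := range_unbounded y; exists n; exact: ltW.
- by move=> m n mn /le_trans; apply; rewrite le_lambda.
exists A, B; split=> // xy.
by have := Adef B; have := Bdef B; rewrite lexx /= => /(lt_le_trans xy) ->.
Qed.

Lemma range_itv_seq (x r : R) : 0 < r -> exists (A : int) (k : nat),
  [/\ [set` [seq lambda (A + i%:Z) | i <- iota 0 k]] =
        range lambda `&` [set y | x < y < x + r],
      lambda (A - 1) <= x /\ x + r <= lambda (A + k%:Z) &
      (0 < k)%N -> x < lambda A /\ lambda (A + k.-1%:Z) < x + r].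
Proof.
move=> r0; have [A [B [Adef Bdef]]] := range_itv x (x + r).
rewrite ltrDl => /(_ r0) AB; pose k := `|B - A|%N.
have kE : A + k%:Z = B by rewrite gez0_abs ?subr_ge0// subrKC.
exists A, k; split.
- apply/seteqP; split=> y /=.
    move=> /mapP[j]; rewrite mem_iota add0n => /andP[_ jk] ->.
    split; first by exists (A + j%:Z).
    by rewrite Adef lerDl/= ltNge Bdef -ltNge -kE ltrD2l.
  move=> [[n _ <-] /andP[]]; rewrite Adef ltNge Bdef -ltNge => An nB.
  apply/mapP; exists `|n - A|%N; last by rewrite gez0_abs ?subr_ge0// subrKC.
  by rewrite mem_iota add0n /= /k; lia.
- by rewrite leNgt Adef kE Bdef lexx; split=> //; lia.
- by move=> k0; rewrite Adef lexx ltNge Bdef -kE; split=> //; lia.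
Qed.

Lemma count_near_mean (k s c e : R) : 0 <= e <= 2^-1 -> 0 <= s -> 0 <= c ->
  s <= (k + 1) + c + e * (k + 1) -> (1 <= k -> (k - 1) - e * (k - 1) <= s + c) ->
  `|k - s| <= 2 * e * s + 2 * c + 2.
Proof.
move=> /andP[e0 e2] s0 c0 s_le le_s.
have k_le : k - 1 <= 2 * (s + c).
  have [k1|k1] := leP 1 k; last lra.
  have : e * (k - 1) <= 2^-1 * (k - 1) by apply: ler_wpM2r => //; lra.
  by have := le_s k1; lra.
have ek : e * (k - 1) <= 2 * e * s + c.
  have := ler_wpM2l e0 k_le; have := ler_wpM2r c0 e2.
  by rewrite mulrDr; lra.
have es : 0 <= e * s by exact: mulr_ge0.
rewrite ler_norml; apply/andP; split; first by lra.
by have [/le_s|] := leP 1 k; lra.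
Qed.

Lemma range_has_uniform_density : has_uniform_density (range lambda) a.
Proof.
move=> eps eps0; pose e := Num.min (eps / (4 * a)) 2^-1.
have e0 : 0 < e by rewrite lt_min divr_gt0 ?mulr_gt0//= invr_gt0.
have e_half : e <= 2^-1 by rewrite ge_min lexx orbT.
have e_eps : 4 * e * a <= eps.
  by rewrite mulrAC mulrC -ler_pdivlMr ?mulr_gt0// ge_min lexx.
have [C C0 lin] := lambda_slope (divr_gt0 e0 a0).
have aC : 0 <= a * C by rewrite mulr_ge0// ltW.
have r0 : 0 < (4 * (a * C) + 4) / eps by rewrite divr_gt0//; lra.
exists ((4 * (a * C) + 4) / eps); split=> // r x r_ge.
have r_gt0 : 0 < r by exact: lt_le_trans r_ge.
have [A [k [traceE [before after] inside]]] := range_itv_seq x r_gt0.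
exists [seq lambda (A + i%:Z) | i <- iota 0 k]; split; [|split=> //].
  rewrite map_inj_uniq ?iota_uniq// => i j.
  by move=> /(inc_inj (le_mono lambda_incr))/addrI[].
rewrite size_map size_iota.
have scale t : a * (t / a + C + e / a * t) = t + a * C + e * t by field; rewrite gt_eqF.
have upper : r * a <= (k%:R + 1) + a * C + e * (k%:R + 1).
  rewrite -scale mulrC ler_pM2l// natr1; have := lin (A - 1) k.+1.
  have -> : A - 1 + k.+1%:Z = A + k%:Z by rewrite -addn1 PoszD addrACA addNr addr0.
  by rewrite ler_norml; lra.
have lower : 1 <= k%:R :> R -> (k%:R - 1) - e * (k%:R - 1) <= r * a + a * C.
  rewrite ler1n => k_gt0; have [xA Bx] := inside k_gt0; have := lin A k.-1.
  have -> : k%:R - 1 = k.-1%:R :> R by rewrite -subn1 natrB.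
  move: (k.-1%:R : R) => t; rewrite ler_norml => /andP[lint _].
  have : t / a - C - e / a * t <= r by lra.
  rewrite -(ler_pM2l a0); have -> : a * (t / a - C - e / a * t) = t - a * C - e * t.
    by field; rewrite gt_eqF.
  lra.
apply: le_trans (count_near_mean _ _ aC upper lower) _; first by rewrite ltW.
  by rewrite mulr_ge0// ltW.
move: r_ge; rewrite ler_pdivrMr// => r_ge.
have := ler_wpM2r (ltW r_gt0) e_eps; lra.
Qed.

End Density.

Section HarmonicNumbers.
Context {R : realType}.
Implicit Types (m n : nat) (x eps delta : R).

Definition harmonic_number m : R := series harmonic m.

Lemma harmonic_number0 : harmonic_number 0 = 0.
Proof. by rewrite /harmonic_number /series /= big_geq. Qed.

Lemma harmonic_numberS m : harmonic_number m.+1 = harmonic_number m + m.+1%:R^-1.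
Proof. by rewrite /harmonic_number /series /= big_nat_recr. Qed.

Lemma le_harmonic_number : {homo harmonic_number : m n / (m <= n)%N >-> m <= n}.
Proof. by apply/nondecreasing_seqP => m; rewrite harmonic_numberS lerDl invr_ge0. Qed.

Lemma harmonic_number_ge0 m : 0 <= harmonic_number m.
Proof. by rewrite -harmonic_number0 le_harmonic_number. Qed.

Lemma harmonic_number_subadditive m n :
  harmonic_number (m + n) <= harmonic_number m + harmonic_number n.
Proof.
elim: n => [|n IH]; first by rewrite addn0 harmonic_number0 addr0.
rewrite addnS !harmonic_numberS addrA lerD// lef_pV2 ?posrE ?ltr0n// ler_nat ltnS.
exact: leq_addl.
Qed.

Lemma harmonic_number_sublinear eps : 0 < eps ->
  exists2 C : R, 0 <= C & forall m, harmonic_number m <= C + eps * m%:R.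
Proof.
move=> eps0; pose M := Num.truncn eps^-1.
exists (harmonic_number M) => [|m]; first exact: harmonic_number_ge0.
elim: m => [|m IH]; first by rewrite mulr0 addr0 le_harmonic_number.
have [mM|Mm] := leqP m.+1 M.
  by apply: ler_wpDr; [rewrite mulr_ge0// ltW|exact: le_harmonic_number].
rewrite harmonic_numberS -[in leRHS]natr1 mulrDr mulr1 addrA lerD// invf_ple ?posrE//.
by apply/ltW/(lt_le_trans (truncnS_gt _)); rewrite ler_nat.
Qed.

Lemma harmonic_number_le m : harmonic_number m <= m%:R.
Proof.
elim: m => [|m IH]; first by rewrite harmonic_number0.
by rewrite harmonic_numberS -[leRHS]natr1 lerD// invf_le1 ?ler1n.
Qed.

Lemma harmonic_number_unbounded x : exists m, x < harmonic_number m.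
Proof.
apply: contrapT => /forallNP bounded; apply: (@dvg_harmonic R).
apply: nondecreasing_is_cvgn; first exact: le_harmonic_number.
by exists x => _ [m _ <-]; rewrite leNgt; apply/negP/bounded.
Qed.

(* The steps of the sequence tend to [0] and its values to infinity. *)
Lemma harmonic_number_dense_mod1 x delta n : 0 < delta -> exists m k : nat,
  (n <= m)%N /\ 0 < harmonic_number m - (x + k%:R) < delta.
Proof.
move=> d0; pose N := maxn n (Num.truncn delta^-1).
pose k := (Num.truncn (harmonic_number N - x)).+1.
have Nk : harmonic_number N < x + k%:R by rewrite -ltrBlDl truncnS_gt.
have [m m_gt m_min] := ex_minnP (harmonic_number_unbounded (x + k%:R)).
have Nm : (N < m)%N.
  rewrite ltnNge; apply/negP => /le_harmonic_number.
  by rewrite leNgt (lt_trans Nk m_gt).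
case: m => // m in m_gt m_min Nm *; exists m.+1, k.
rewrite (leq_trans (leq_maxl _ _) (ltnW Nm)) subr_gt0 m_gt harmonic_numberS; split=> //=.
have m_le : harmonic_number m <= x + k%:R.
  by rewrite leNgt; apply/negP => /m_min; rewrite ltnn.
suff : m.+1%:R^-1 < delta by move: m.+1%:R^-1 => step; lra.
rewrite invf_plt ?posrE//; apply: lt_le_trans (truncnS_gt _) _; rewrite ler_nat.
by apply: leq_trans Nm; rewrite ltnS leq_maxr.
Qed.

End HarmonicNumbers.

Section Nodes.
Context {R : realType}.
Variables (p : nat -> nat).

Fixpoint stage (n : nat) : nat :=
  if n is n'.+1 then if n == p (stage n').+1 then (stage n').+1 else stage n' else 0.

Lemma stage_step n : (stage n <= stage n.+1 <= (stage n).+1)%N.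
Proof. by rewrite /=; case: ifP; rewrite leqnSn leqnn. Qed.

Lemma leq_stage : {homo stage : m n / (m <= n)%N}.
Proof. by apply: homo_leq leq_trans _ => // n; case/andP: (stage_step n). Qed.

Lemma stage_addn n k : (stage (n + k) <= stage n + k)%N.
Proof.
elim: k => [|k IH]; first by rewrite !addn0.
by rewrite !addnS; case/andP: (stage_step (n + k)) => _ /leq_trans; apply.
Qed.

Variable (a : R).
Hypothesis a0 : 0 < a.

Definition node (n : int) : R :=
  (n%:~R + harmonic_number (stage `|Num.max n 0|%N)) / a.

Lemma node_nat (n : nat) : node n%:Z = (n%:R + harmonic_number (stage n)) / a.
Proof. by rewrite /node -pmulrn (max_idPl _). Qed.

Lemma node_gap m n : m < n -> node m + a^-1 <= node n.
Proof.
move=> mn; rewrite /node -[X in _ + X]mul1r -mulrDl ler_pM2r ?invr_gt0// addrAC lerD//.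
  by rewrite -[1]/(1%:~R) -intrD ler_int; lia.
by apply: le_harmonic_number; apply: leq_stage; lia.
Qed.

Lemma node_slope : asymptotic_slope node a^-1.
Proof.
move=> eps eps0; have aeps0 : 0 < a * eps by exact: mulr_gt0.
have [C C0 sublinear] := harmonic_number_sublinear aeps0.
exists (C / a) => [|n k]; first by rewrite divr_ge0// ltW.
pose s (j : int) := stage `|Num.max j 0|%N.
have -> : node (n + k%:Z) - node n - k%:R / a =
    (harmonic_number (s (n + k%:Z)) - harmonic_number (s n)) / a.
  by rewrite /node -/(s _) -/(s _) intrD -pmulrn; ring.
have s_le : (s n <= s (n + k%:Z)%R)%N by apply: leq_stage; lia.
have s_ge : (s (n + k%:Z)%R <= s n + k)%N.
  by apply: leq_trans (stage_addn _ _); apply: leq_stage; lia.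
rewrite normrM [`|a^-1|]gtr0_norm ?invr_gt0// ler_pdivrMr//.
rewrite ger0_norm ?subr_ge0 ?le_harmonic_number//.
have -> : (C / a + eps * k%:R) * a = C + a * eps * k%:R by field; rewrite gt_eqF.
apply: le_trans (sublinear k); rewrite lerBlDl.
by apply: le_trans (le_harmonic_number s_ge) (harmonic_number_subadditive _ _).
Qed.

Hypotheses (p0 : p 0 = 0%N) (pS : forall m, (p m < p m.+1)%N).

Lemma leq_id_incr m : (m <= p m)%N.
Proof. by elim: m => // m IH; exact: leq_ltn_trans (pS m). Qed.

Lemma stageP n : (p (stage n) <= n < p (stage n).+1)%N.
Proof.
elim: n => [|n /andP[IH1 IH2]] /=; first by rewrite p0 leqnn -{1}p0 pS.
case: eqP => [->|/eqP ne]; first by rewrite leqnn pS.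
by rewrite ltn_neqAle ne (leqW IH1).
Qed.

Lemma stageE m n : (p m <= n < p m.+1)%N -> stage n = m.
Proof.
have p_lt := leqW_mono (leq_mono (homo_ltn ltn_trans pS)).
move=> /andP[mn nm]; have /andP[sn ns] := stageP n.
apply/eqP; rewrite eqn_leq -ltnS -p_lt (leq_ltn_trans sn nm) /=.
by rewrite -ltnS -p_lt (leq_ltn_trans mn ns).
Qed.

End Nodes.

(** * Uniqueness *)

Section SampledPolynomial.
Context {R : realType}.
Variables (f : R -> R[i]) (C a : R).
Hypotheses (a0 : 0 < a) (fC : quadratic_decay C (fun x => normc (f x))).
Implicit Types (x t y : R) (p q n : nat).

Let C0 : 0 <= C.
Proof. exact: quadratic_decay_cst_ge0 (fun x => normc_ge0 (f x)) fC. Qed.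

Lemma periodization_normc_le n q x : (0 < n <= q)%N -> 2 * a * `|x| <= n%:R ->
  periodization (fun y => normc (f y)) a^-1 q x <=
    2 * n%:R * C + 16 * C * a ^+ 2 / n%:R.
Proof.
move=> nq xn; set h := periodization _ _; rewrite -(subrK (h n x) (h q x)) addrC.
apply: lerD.
  apply: (@le_trans _ _ (\sum_(i < n + n) C)).
    by apply: ler_sum => i _; exact: (quadratic_decay_bounded _ C0 fC).
  rewrite sumr_const card_ord -[C *+ _]mulr_natl natrD le_eqVlt.
  by apply/orP; left; apply/eqP; ring.
apply: le_trans (ler_norm _) _; have -> : 16 * C * a ^+ 2 = 16 * C / a^-1 ^+ 2.
  by rewrite exprVn invrK.
apply: periodization_cauchy => // [|y|]; first by rewrite invr_gt0.
  by rewrite /= ger0_norm ?normc_ge0//; exact: fC.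
by rewrite ler_pdivlMr// mulrAC.
Qed.

Definition sampled_poly x p q : {poly R[i]} :=
  \poly_(j < p + q) f (x + (p%:R - 1 - j%:R) * a^-1).

Lemma normc_sampled_poly_le x p q y : (p <= q)%N ->
  normc (sampled_poly x p q).[cis y] <= periodization (fun y => normc (f y)) a^-1 q x.
Proof.
move=> pq; rewrite (periodization_split _ _ _ pq); apply: ler_wpDr.
  by apply: sumr_ge0 => n _; exact: normc_ge0.
rewrite horner_poly; apply: le_trans (normc_sum _ _ _) _; apply: ler_sum => j _.
by rewrite normcM normcX normc_cis expr1n mulr1.
Qed.

Lemma normc_sampled_polyE x p q t : (p <= q)%N ->
  (forall n, (p <= n < q)%N -> f (x + n%:R / a) = 0) ->
  normc (sampled_poly x p q).[cis (a^-1 * t)] =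
  normc (periodization (fun y => f y * cis (- (t * y))) a^-1 q x).
Proof.
move=> pq f0; rewrite (periodization_split _ _ _ pq).
rewrite [X in _ + X]big_nat_cond [X in _ + X]big1 ?addr0 => [|n /andP[npq _]]; last first.
  by rewrite f0// mul0r.
have -> : \sum_(j < p + q) f (x + (p%:R - 1 - j%:R) / a) *
    cis (- (t * (x + (p%:R - 1 - j%:R) / a))) =
    cis (- (t * (x + (p%:R - 1) / a))) * (sampled_poly x p q).[cis (a^-1 * t)].
  rewrite horner_poly mulr_sumr; apply: eq_bigr => j _.
  rewrite mulrCA -cisMn -cisD; congr (_ * cis _).
  by field; rewrite gt_eqF.
by rewrite normcM normc_cis mul1r.
Qed.

End SampledPolynomial.

Section LongGap.
Context {R : realType}.
Notation mu := (@lebesgue_measure R).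
Variables (a : R) (K : set R).
Hypotheses (a0 : 0 < a) (cK : compact K) (Ka : K `<=` `[0, a[).
Hypothesis muK_gt0 : (0 < mu K)%E.

(* [(p + 1) ^ 2] and [p + 1] eventually exceed the constants that depend on [f], which is
   not known when the sequence of gaps is chosen. *)
Definition long_gap (p q : nat) : Prop := (2 * p < q)%N /\ forall P : {poly R[i]},
  (forall x, normc P.[cis x] <= p.+1%:R ^+ 2) ->
  (forall x, K x -> normc P.[cis (a^-1 * x)] <= p.+1%:R / q%:R) ->
  forall k, (k < 3 * p)%N -> normc P`_k <= p.+1%:R^-1.

Lemma long_gap_exists p : exists q, long_gap p q.
Proof.
have M0 : 0 < p.+1%:R ^+ 2 :> R by rewrite exprn_gt0.
have e0 : 0 < p.+1%:R^-1 :> R by rewrite invr_gt0.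
have [eps eps0 small] := coefs_small a0 cK Ka muK_gt0 (3 * p) M0 e0.
exists (maxn (2 * p) (Num.truncn (p.+1%:R / eps))).+1.
split=> [|P PM PK]; first by rewrite ltnS leq_maxl.
apply: small => // x Kx; apply: le_trans (PK x Kx) _.
rewrite ler_pdivrMr// mulrC -ler_pdivrMr//.
by apply: le_trans (ltW (truncnS_gt _)) _; rewrite ler_nat ltnS leq_maxr.
Qed.

End LongGap.

Lemma near_small_eq0 (R : realType) (u : R -> R) (x : R) : {for x, continuous u} ->
  (forall eps, 0 < eps -> exists2 y, `|y - x| < eps & `|u y| <= eps) -> u x = 0.
Proof.
move=> cu small; apply/eqP; rewrite -normr_le0; apply/ler_addgt0Pr => e e0; rewrite add0r.
have e2 : 0 < e / 2 by rewrite divr_gt0.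
have [r r0 ur] : exists2 r, 0 < r & forall y, `|x - y| < r -> `|u x - u y| <= e / 2.
  by have /cvgrPdist_le /(_ _ e2)/nbhs_ballP[r /= r0 ur] := cu; exists r.
have [|y] := small (Num.min r (e / 2)); first by rewrite lt_min r0.
rewrite distrC lt_min le_min => /andP[/ur uxy _] /andP[_ uy].
by rewrite -[u x](subrK (u y)) (le_trans (ler_normD _ _))// [leRHS]splitr lerD.
Qed.

Section Uniqueness.
Context {R : realType}.
Variables (a : R) (K : set R) (p : nat -> nat) (f : R -> R[i]) (C : R).
Hypotheses (a0 : 0 < a) (p0 : p 0 = 0%N) (gap : forall m, long_gap a K (p m) (p m.+1)).
Hypotheses (cf : continuousC f) (fC : quadratic_decay C (fun x => normc (f x))).
Hypothesis fourier0 : forall t, K t -> forall k : int,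
  fourier_re (fun x => Re (f x)) (fun x => Im (f x)) (t + k%:~R * a) = 0 /\
  fourier_im (fun x => Re (f x)) (fun x => Im (f x)) (t + k%:~R * a) = 0.
Hypothesis f_node : forall n, f (node p a n) = 0.

Let p_gap m : (2 * p m < p m.+1)%N. Proof. by have [] := gap m. Qed.

Let pS m : (p m < p m.+1)%N.
Proof. by apply: leq_ltn_trans (p_gap m); rewrite leq_pmull. Qed.

Let C0 : 0 <= C.
Proof. exact: quadratic_decay_cst_ge0 (fun x => normc_ge0 (f x)) fC. Qed.

Lemma sample_small m k : (0 < p m)%N -> 4 * C + 16 * C * a ^+ 2 <= (p m)%:R ->
  (k <= 2 * p m)%N -> normc (f ((harmonic_number m - k%:R) / a)) <= (p m).+1%:R^-1.
Proof.
move=> pm0 pm_ge k_le; set x := harmonic_number m / a.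
have pm1 : 1 <= (p m)%:R :> R by rewrite ler1n.
have Ca : 0 <= C * a ^+ 2 by rewrite mulr_ge0 ?sqr_ge0.
have pq : (p m <= p m.+1)%N by exact: ltnW.
have ax : 2 * a * `|x| <= (2 * p m)%:R.
  have -> : 2 * a * `|x| = 2 * harmonic_number m.
    rewrite /x ger0_norm ?divr_ge0 ?harmonic_number_ge0 ?(ltW a0)//.
    by field; rewrite gt_eqF.
  rewrite natrM ler_pM2l//; apply: le_trans (harmonic_number_le m) _.
  by rewrite ler_nat leq_id_incr.
have x_node n : (p m <= n < p m.+1)%N -> f (x + n%:R / a) = 0.
  move=> npq; rewrite -(f_node n%:Z) node_nat (stageE p0 pS npq).
  by rewrite /x -mulrDl addrC.
have idx : ((p m).-1 + k < 3 * p m)%N by lia.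
have -> : f ((harmonic_number m - k%:R) / a) =
    (sampled_poly f a x (p m) (p m.+1))`_((p m).-1 + k).
  rewrite coef_poly; have -> : ((p m).-1 + k < p m + p m.+1)%N.
    by have := p_gap m; lia.
  congr f; rewrite natrD -subn1 natrB// /x; ring.
apply: (gap m).2 idx => [y|t Kt].
- apply: le_trans (normc_sampled_poly_le _ _ _ _ pq) _.
  have := @periodization_normc_le _ _ _ _ a0 fC (2 * p m) (p m.+1) x.
  rewrite muln_gt0 pm0 (ltnW (p_gap m)) => /(_ isT ax) /le_trans; apply.
  have Cap : C * a ^+ 2 <= C * a ^+ 2 * (p m)%:R by rewrite ler_peMr.
  have tail_le : 16 * C * a ^+ 2 / (2 * p m)%:R <= 8 * C * a ^+ 2.
    by rewrite natrM ler_pdivrMr ?mulr_gt0 ?ltr0n//; lra.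
  move: tail_le; move: (_ / (2 * p m)%:R) => tail tail_le.
  rewrite natrM -[(p m).+1%:R]natr1 sqrrD expr1n mulr1 expr2.
  by have := ler_wpM2l (ler0n R (p m)) pm_ge; lra.
- rewrite normc_sampled_polyE//.
  apply: le_trans (normc_periodization_le cf fC a0 (fourier0 Kt) _ _) _.
  + exact: leq_ltn_trans (p_gap m).
  + by apply: le_trans ax _; rewrite ler_nat ltnW.
  + rewrite ler_pM2r ?invr_gt0 ?ltr0n ?(leq_ltn_trans _ (p_gap m))// -[(p m).+1%:R]natr1.
    by move: C0; lra.
Qed.

Lemma small_sample_near x eps : 0 < eps -> exists2 y, `|y - x| < eps & normc (f y) <= eps.
Proof.
move=> eps0; pose N := (Num.truncn (4 * C + 16 * C * a ^+ 2 + a * `|x| + eps^-1)).+1.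
have [m [k [Nm /andP[lo hi]]]] :=
  harmonic_number_dense_mod1 (a * x) N (mulr_gt0 a0 eps0).
have Npm : (N <= p m)%N by exact: leq_trans Nm (leq_id_incr pS m).
have pm0 : (0 < p m)%N by exact: leq_trans Npm.
have pm_ge : 4 * C + 16 * C * a ^+ 2 + a * `|x| + eps^-1 <= (p m)%:R.
  by apply: le_trans (ltW (truncnS_gt _)) _; rewrite ler_nat.
have Ca : 0 <= C * a ^+ 2 by rewrite mulr_ge0 ?sqr_ge0.
have ax : a * x <= a * `|x| /\ - (a * `|x|) <= a * x.
  have := ler_norm (a * x); have := ler_norm (- (a * x)).
  by rewrite normrN normrM gtr0_norm//; lra.
have ax0 : 0 <= a * `|x| by rewrite mulr_ge0// ltW.
have epsV : 0 < eps^-1 by rewrite invr_gt0.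
exists ((harmonic_number m - k%:R) / a).
  have -> : (harmonic_number m - k%:R) / a - x = (harmonic_number m - (a * x + k%:R)) / a.
    by field; rewrite gt_eqF.
  by rewrite gtr0_norm ?divr_gt0// ltr_pdivrMr// [eps * a]mulrC.
apply: le_trans (sample_small pm0 _ _) _; first by lra.
- have m_le : m%:R <= (p m)%:R :> R by rewrite ler_nat leq_id_incr.
  by rewrite -(ler_nat R) natrM; have := @harmonic_number_le R m; move: C0; lra.
- by rewrite invf_ple ?posrE// -[(p m).+1%:R]natr1; move: C0; lra.
Qed.

Lemma vanish_everywhere x : Re (f x) = 0 /\ Im (f x) = 0.
Proof.
have [cRe cIm] := cf; split.
- apply: (near_small_eq0 (cRe x)) => eps /(small_sample_near x)[y yx fy].
  by exists y => //; exact: le_trans (normc_ge_Re _) fy.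
- apply: (near_small_eq0 (cIm x)) => eps /(small_sample_near x)[y yx fy].
  by exists y => //; exact: le_trans (normc_ge_Im _) fy.
Qed.

End Uniqueness.

Theorem theorem4 (R : realType) (S : set R) (a : R) :
  lebesgue_measurable S -> 0 < a -> (leb (Sa S a) < a%:E)%E ->
  exists L : set R, uniformly_discrete L /\ has_uniform_density L a /\
    uniqueness_set_YS S L.
Proof.
move=> _ a0 Sa_lt.
have [||K [cK Ka muK_gt0 KS]] :=
    @compact_disjoint_positive R `[0, a[%classic (Sa S a) (measurable_itv _).
- by rewrite lebesgue_measure_period// ltry.
- by rewrite lebesgue_measure_period.
have [next next_gap] := choice (long_gap_exists a0 cK Ka muK_gt0).
pose p m := iter m next 0%N.
have a_inv : 0 < a^-1 by rewrite invr_gt0.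
have step := node_gap p a0.
exists (range (node p a)); split; [|split].
- exact: uniformly_discrete_range a_inv step.
- apply: range_has_uniform_density a0 _ (node_slope p a0) => m n /step; lra.
move=> u v [[cu [cv [C uvC]]] uv_spec] uv_node x.
have p_gap m : long_gap a K (p m) (p m.+1) by exact: next_gap.
apply: (@vanish_everywhere R a K p (fun x => u x +i* v x)%C C a0 erefl p_gap (conj cu cv)).
- by move=> y; rewrite /= ler_pdivlMr ?ltr_wpDr ?sqr_ge0// mulrC.
- move=> t Kt k; apply: uv_spec => St.
  suff : (K `&` Sa S a) t by rewrite KS.
  split=> //; split; first by exists (- k); rewrite mulrNz mulNr opprK.
  by have := Ka t Kt; rewrite /= in_itv/= => /andP[-> /ltW].
- by move=> n; have [|-> ->] := uv_node (node p a n); first by exists n.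
Qed.
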